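(* Let $\Sigma_i(\theta_i)\sim\mathbf f_i$ and let $\bar\Sigma_i$ be the nominal model of system $i\in\{1,2\}$. Then for all $q\ge1$, $$\mathrm{dist}^{q}_{\Sigma_1,\Sigma_2,\delta_g}\ \ge\ \inf_{\pi_{\mathbf f}\in\Pi(\mathbf f_1,\mathbf f_2)}\left(\mathrm{dist}^{\mathrm{nom}}_{\Sigma_1,\Sigma_2}-\sum_{i=1}^2\mathbb{E}_{\pi_{\mathbf f}}\left[\mathrm{Gap}_i(\theta_i)\right]\right)_+^q.$$
   Context: $(x)_+^q=(\max(0,x))^q$. A plant model is a state-space triple $\Sigma=(A,B,C)$ with $A\in\mathbb{R}^{n\times n}$, $B\in\mathbb{R}^{n\times m}$, $C\in\mathbb{R}^{l\times n}$, i.e. $\dot x=Ax+Bu$, $y=Cx$, regarded as a point of $\mathbb{R}^{n^2+nm+ln}$; its transfer function is $\mathbf{TF}(\Sigma)(s)=C(sI-A)^{-1}B$. For $i\in\{1,2\}$, the nominal model is $\bar\Sigma_i=(A_i,B_i,C_i)$ and the perturbed model is $\Sigma_i(\theta_i)=(A_i(\theta_i),B_i(\theta_i),C_i(\theta_i))$, with a random parameter $\theta_i\in\Theta_i\subseteq\mathbb{R}^p$ of distribution $\mathbf f_{\theta_i}$ (the paper's standing choice is Gaussian, $\mathbf f_{\theta_i}=\mathcal N(\mu_{\theta_i},\Sigma_{\theta_i})$). The measurable map $\Phi_i$ sends $\theta_i$ to $\Sigma_i(\theta_i)$, and $\mathbf f_i=(\Phi_i)_\#\mathbf f_{\theta_i}$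 (push-forward) is the distribution of the perturbed model. There is a parameter value $\bar\theta_i$ in the support of $\mathbf f_{\theta_i}$ with $\Sigma_i(\bar\theta_i)=\bar\Sigma_i$. Gap metric: let $\mathcal{H}_2$ be the space of Fourier transforms of $\mathcal{L}_2$ (finite-energy, vector-valued) signals supported on positive time. For a plant with real rational transfer matrix $P$, take a normalized right coprime factorisation $P=ND^{-1}$, where $N,D$ are proper, stable, real rational matrices, there are proper stable rational $X,Y$ with $XN+YD=I$, and $N^\star N+D^\star D=I$ (on the imaginary axis). The graph of $P$ is the closed subspace $\mathcal{G}_P=\{(u,y)\in\mathcal{H}_2\times\mathcal{H}_2: y=Pu\}=\begin{bmatrix}D\\N\end{bmatrix}\mathcal{H}_2$, and $\Pi_{\mathcal{G}_P}$ is the orthogonal projection onto it. The gap metric is $\delta_g(P_1,P_2)=\|\Pi_{\mathcal{G}_{P_1}}-\Pi_{\mathcal{G}_{P_2}}\|$ (operator norm), and for state-space models $\delta_g(\Sigma_1,\Sigma_2)$ means $\delta_g(\mathbf{TF}(\Sigma_1),\mathbf{TF}(\Sigma_2))$. $\mathrm{Gap}_i(\theta_i):=\delta_g(\bar\Sigma_i,\Sigma_i(\theta_i))$ and $\mathrm{dist}^{\mathrm{nom}}_{\Sigma_1,\Sigma_2}:=\delta_g(\bar\Sigma_1,\bar\Sigma_2)$. $\Pi(\mathbf f_1,\mathbf f_2)$ is the set of all joint distributions with marginals $\mathbf f_1$ and $\mathbf f_2$, and $\mathbb{E}_{\pi_{\mathbf f}}$ is expectation when the pair of perturbed models $(\Sigma_1,\Sigma_2)$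 has joint distribution $\pi_{\mathbf f}$. The type-$q$ inter-system distance is $$\mathrm{dist}^{q}_{\Sigma_1,\Sigma_2,\delta_g}:=\inf_{\pi_{\mathbf f}\in\Pi(\mathbf f_1,\mathbf f_2)}\int_{\mathrm{supp}(\mathbf f_1)\times\mathrm{supp}(\mathbf f_2)}\delta_g(\Sigma_1,\Sigma_2)^q\,\pi_{\mathbf f}(d\Sigma_1,d\Sigma_2)$$ (the superscript $q$ is part of the notation; no $q$-th root is taken). *)

(* Defs.v *)
From HB Require Import structures.
From mathcomp Require Import all_boot all_order all_algebra.
From mathcomp Require Import complex.
From mathcomp Require Import all_classical all_reals all_analysis.

Set Implicit Arguments.
Unset Strict Implicit.
Unset Printing Implicit Defensive.

Import Order.TTheory GRing.Theory Num.Theory.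
Import numFieldNormedType.Exports.

Local Open Scope classical_set_scope.
Local Open Scope ring_scope.
Local Open Scope complex_scope.

Notation borel T := (g_sigma_algebraType (@open T)).

Section HardySpace.
Context {R : realType}.
Local Notation C := R[i].

Definition cexp (z : C) : C :=
  (expR (complex.Re z))%:C * (cos (complex.Im z) +i* sin (complex.Im z)).

Definition cintegral (f : R -> C) : C :=
  (\int[lebesgue_measure]_t complex.Re (f t)) +i*
  (\int[lebesgue_measure]_t complex.Im (f t)).

Definition energy k (f : R -> 'cV[C]_k) : \bar R :=
  (\int[lebesgue_measure]_t
     (\sum_j (complex.Re (f t j 0) ^+ 2 + complex.Im (f t j 0) ^+ 2))%:E)%E.

Definition causal_L2 k : set (R -> 'cV[C]_k) :=
  [set f : R -> 'cV[C]_k |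
           [/\ forall j, measurable_fun setT (fun t : R => complex.Re (f t j 0)),
               forall j, measurable_fun setT (fun t : R => complex.Im (f t j 0)),
               forall t, t < 0 -> f t = 0
             & (energy f < +oo)%E]].

Definition L2dot k (f g : R -> 'cV[C]_k) : C :=
  cintegral (fun t => \sum_j (f t j 0)^* * g t j 0).

(* The Fourier transform of a signal supported on positive time extends       *)
(* analytically to Re s > 0, where it is given by an absolutely convergent    *)
(* integral.  A transform is represented by its values on this half-plane,    *)
(* which determine it; the value 0 elsewhere makes equality of transforms     *)
(* the same thing as equality of functions.                                   *)
Definition fourier k (f : R -> 'cV[C]_k) (s : C) : 'cV[C]_k :=
  if 0 < complex.Re s
  then \col_j cintegral (fun t => cexp (- s * t%:C) * f t j 0)
  else 0.

Definition H2 k : set (C -> 'cV[C]_k) := @fourier k @` @causal_L2 k.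

Definition signal k (F : C -> 'cV[C]_k) : R -> 'cV[C]_k :=
  xget (fun=> 0) [set f | causal_L2 f /\ fourier f = F].

(* The Hilbert structure of H2 is the one making the transform unitary        *)
(* (Plancherel); signal F is determined by F almost everywhere.               *)
Definition H2dot k (F G : C -> 'cV[C]_k) : C := L2dot (signal F) (signal G).

End HardySpace.
Arguments H2 : clear implicits.

Section GapMetric.
Context {R : realType} {m l : nat}.
Local Notation C := R[i].

(* Pairs (u, y) of transforms of an input and an output.                      *)
Local Notation io := ((C -> 'cV[C]_m) * (C -> 'cV[C]_l))%type.

Definition io_space : set io := H2 R m `*` H2 R l.

Definition io_dot (w z : io) : C := H2dot w.1 z.1 + H2dot w.2 z.2.

Definition io_norm (w : io) : R := Num.sqrt (complex.Re (io_dot w w)).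

(* A rational matrix P is represented by its values; these are meaningless at *)
(* the poles, so y = P u is required outside a finite set S.                  *)
Definition graph (P : C -> 'M[C]_(l, m)) : set io :=
  [set w | io_space w /\
     exists S : seq C, forall s : C, 0 < complex.Re s -> s \notin S ->
       w.2 s = P s *m w.1 s].

Definition orthproj (G : set io) (w : io) : io :=
  xget 0 [set g | G g /\ forall h, G h -> io_dot h (w - g) = 0].

Definition gap_metric (P1 P2 : C -> 'M[C]_(l, m)) : R :=
  sup [set io_norm (orthproj (graph P1) w - orthproj (graph P2) w)
      | w in [set w | io_space w /\ io_norm w <= 1]].

End GapMetric.

Section Models.
Context {R : realType} {n m l : nat}.
Local Notation C := R[i].

(* (A, B, C), the output matrix being the last component.                     *)
Definition model : Type := ('M[R]_n * 'M[R]_(n, m) * 'M[R]_(l, n))%type.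
HB.instance Definition _ := Topological.on model.
HB.instance Definition _ := Pointed.on model.

Definition TF (Sigma : model) (s : C) : 'M[C]_(l, m) :=
  let: (A, B, K) := Sigma in
  map_mx (real_complex R) K
    *m invmx (s%:M - map_mx (real_complex R) A)
    *m map_mx (real_complex R) B.

Definition delta_g (Sigma1 Sigma2 : model) : R :=
  gap_metric (TF Sigma1) (TF Sigma2).

End Models.
Arguments model : clear implicits.

Definition supp {R : realType} {T : topologicalType} (mu : set T -> \bar R) :
  set T := [set x | forall U, open U -> U x -> (0 < mu U)%E].

(* f is the distribution of Phi(theta), theta in Theta being distributed      *)
(* according to ftheta, and Sigmabar is the nominal model, attained at the    *)
(* parameter thetabar.                                                        *)
Definition perturbed_model {R : realType} {n m l p : nat}
    (Theta : set (borel 'rV[R]_p)) (ftheta : probability (borel 'rV[R]_p) R)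
    (Phi : borel 'rV[R]_p -> borel (model R n m l))
    (thetabar : 'rV[R]_p) (Sigmabar : model R n m l)
    (f : probability (borel (model R n m l)) R) : Prop :=
  [/\ measurable Theta /\ ftheta Theta = 1%E,
      measurable_fun Theta Phi,
      forall E, measurable E -> f E = ftheta (Theta `&` Phi @^-1` E),
      Theta thetabar /\ supp ftheta thetabar
    & Phi thetabar = Sigmabar].

Section Distance.
Context {R : realType} {n m l : nat}.
Local Notation M := (borel (model R n m l)).

Definition couplings (f1 f2 : probability M R) : set (probability (M * M)%type R) :=
  [set pi | (forall E, measurable E -> pi (E `*` setT) = f1 E) /\
            (forall E, measurable E -> pi (setT `*` E) = f2 E)].

Definition type_q_dist (q : R) (f1 f2 : probability M R) : \bar R :=
  ereal_inf [set (\int[pi]_(S in supp f1 `*` supp f2)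
                    (delta_g S.1 S.2 `^ q)%:E)%E
            | pi in couplings f1 f2].

End Distance.

(* Main.v *)
Require Import Defs.
From HB Require Import structures.
From mathcomp Require Import all_boot all_order all_algebra.
From mathcomp Require Import complex ring lra.
From mathcomp Require Import all_classical all_reals all_analysis.
From mathcomp Require Import measurable_realfun.

Set Implicit Arguments.
Unset Strict Implicit.
Unset Printing Implicit Defensive.

Import Order.TTheory GRing.Theory Num.Theory.
Import numFieldNormedType.Exports.

Local Open Scope classical_set_scope.
Local Open Scope ring_scope.

(** The gap metric is a pseudometric with values in [0, 2], so the triangle
    inequality gives, for all perturbed models [S1] and [S2],
      delta_g S1 S2 >= nom - delta_g Sigmabar1 S1 - delta_g Sigmabar2 S2,
    where nom is the distance of the nominal models.  For a fixed coupling let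
    [c] be nom minus the two expected gaps.  If [c <= 0] the bound is 0.  When
    [c > 0], the power [x^q] lies
    above its tangent at [c]; replacing [x] by the right-hand side above and
    integrating leaves exactly [c^q] ([tangent_integral_bound]).  This is
    Jensen's inequality with the triangle inequality built in.

    The expectation of the right-hand side splits into a sum only because the
    two gaps are measurable: the integral of a nonmeasurable nonnegative
    function is a lower integral, and lower integrals are not additive.
    Measurability of the gap to a fixed model ([measurable_delta_g]) is the
    heart of the proof.  Clearing
    denominators, the graph of [C (s - A)^-1 B] consists of the pairs [(u, y)]
    with [p(s) y(s) = Q(s) u(s)] on the right half-plane, where
    [p = det (s - A)] and [Q = C adj(s - A) B].  As evaluation at [s] is a
    bounded functional, the graph is the orthogonal complement of a family of
    vectors that depend continuously on the model ([graph_perp],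
    [graph_normal_cvg]), although the graph itself jumps when an unstable mode
    becomes uncontrollable or unobservable.  The squared norm of the projection
    of [w] on the graph is therefore an infimum of continuous functions of the
    model, hence upper semicontinuous ([dist2_usc]); polarization makes the
    squared norm of the difference of two projections of [w] measurable, and
    [delta_g > a] is an open condition on [w], which a countable dense set of
    vectors decides ([gap_gtP]).

    All this takes place in a separable Hilbert space.  Completeness is the
    Riesz-Fischer theorem ([L2_complete]).  That the scalar product of
    transforms is well defined, and that the kernels at the positive integers
    are total, both come from Lerch's theorem ([lerch]): a Laplace transform is
    determined by its values at the positive integers.

    Finally, the cost is integrated over the product of the supports only, but
    supports have full measure because the space of models has a countable
    basis ([model_suppC0]). *)

(** * Real and imaginary parts *)

Section ReIm.
Context {R : realType}.

Lemma ReM_real (r : R) (z : R[i]) : complex.Re (r%:C%C * z) = r * complex.Re z.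
Proof. by case: z => a b /=; rewrite mul0r subr0. Qed.

Lemma ReD (z t : R[i]) : complex.Re (z + t) = complex.Re z + complex.Re t.
Proof. by case: z => a b; case: t. Qed.

Lemma ImD (z t : R[i]) : complex.Im (z + t) = complex.Im z + complex.Im t.
Proof. by case: z => a b; case: t. Qed.

Lemma ReM (z w : R[i]) : complex.Re (z * w) =
  complex.Re z * complex.Re w - complex.Im z * complex.Im w.
Proof. by case: z w => a b [c d]. Qed.

Lemma ImM (z w : R[i]) : complex.Im (z * w) =
  complex.Re z * complex.Im w + complex.Im z * complex.Re w.
Proof. by case: z w => a b [c d]. Qed.

Lemma Re_conj (z : R[i]) : complex.Re (z^*)%C = complex.Re z.
Proof. by case: z. Qed.

Lemma Im_conj (z : R[i]) : complex.Im (z^*)%C = - complex.Im z.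
Proof. by case: z. Qed.

Lemma complexP (z w : R[i]) : complex.Re z = complex.Re w ->
  complex.Im z = complex.Im w -> z = w.
Proof. by case: z w => a b [c d] /= -> ->. Qed.

End ReIm.

(** * Hilbert spaces, orthogonal projections and their gap *)

Section Hilbert.
Context {R : realType} {V : lmodType R[i]}.
Implicit Types (H L G : set V) (dot : V -> V -> R[i]) (x y z w : V).

Definition rdot dot x y : R := complex.Re (dot x y).
Definition nrm2 dot x : R := complex.Re (dot x x).
Definition nrm dot x : R := Num.sqrt (nrm2 dot x).

(** The vectors are the members of a subset [H] of an ambient module, because
    transforms of finite-energy signals live among all functions of [s].  The
    scalar product is linear in its second argument. *)
Record hilbert H dot : Prop := Hilbert {
  hil0 : H 0;
  hilP : forall a x y, H x -> H y -> H (a *: x + y);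
  dotP : forall a x y z, H x -> H y -> H z ->
    dot x (a *: y + z) = a * dot x y + dot x z;
  dotC : forall x y, H x -> H y -> dot y x = (dot x y)^*%C;
  nrm2_ge0 : forall x, H x -> 0 <= nrm2 dot x;
  nrm2_eq0 : forall x, H x -> nrm2 dot x = 0 -> x = 0;
  hilcomplete : forall u : nat -> V, (forall n, H (u n)) ->
    (forall e : R, 0 < e -> exists N, forall i j, (N <= i)%N -> (N <= j)%N ->
       nrm2 dot (u i - u j) < e) ->
    exists2 x, H x & forall e : R, 0 < e -> exists N, forall i, (N <= i)%N ->
       nrm2 dot (u i - x) < e }.

Definition submodule L := L 0 /\ forall a x y, L x -> L y -> L (a *: x + y).

Definition perp H dot L : set V := [set w | H w /\ forall k, L k -> dot k w = 0].

Section Theory.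
Variables (H : set V) (dot : V -> V -> R[i]) (hH : hilbert H dot).
Local Notation rd := (rdot dot).
Local Notation n2 := (nrm2 dot).
Local Notation nm := (nrm dot).

Lemma submodule_hil : submodule H.
Proof. by split; [exact: hil0 hH|exact: hilP hH]. Qed.

Lemma submoduleZ L a x : submodule L -> L x -> L (a *: x).
Proof. by move=> [L0 LP] Lx; rewrite -[_ *: _]addr0; apply: LP. Qed.

Lemma submoduleD L x y : submodule L -> L x -> L y -> L (x + y).
Proof. by move=> [L0 LP] Lx Ly; rewrite -[x]scale1r; apply: LP. Qed.

Lemma submoduleN L x : submodule L -> L x -> L (- x).
Proof. by move=> sL Lx; rewrite -scaleN1r; apply: submoduleZ. Qed.

Lemma submoduleB L x y : submodule L -> L x -> L y -> L (x - y).
Proof. by move=> sL Lx Ly; apply: submoduleD => //; apply: submoduleN. Qed.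

Let H0 : H 0 := hil0 hH.
Let HD x y : H x -> H y -> H (x + y).
Proof. exact: (submoduleD submodule_hil). Qed.
Let HZ a x : H x -> H (a *: x).
Proof. exact: (submoduleZ _ submodule_hil). Qed.
Let HB x y : H x -> H y -> H (x - y).
Proof. exact: (submoduleB submodule_hil). Qed.
Let HN x : H x -> H (- x).
Proof. exact: (submoduleN submodule_hil). Qed.
Hint Resolve H0 HD HZ HB HN : core.

Lemma dotD x y z : H x -> H y -> H z -> dot x (y + z) = dot x y + dot x z.
Proof. by move=> *; rewrite -{1}[y]scale1r (dotP hH)// mul1r. Qed.

Lemma dot0r x : H x -> dot x 0 = 0.
Proof.
move=> Hx; have := dotD Hx H0 H0; rewrite addr0 => /eqP.
by rewrite -subr_eq subrr => /eqP <-.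
Qed.

Lemma dotZ a x y : H x -> H y -> dot x (a *: y) = a * dot x y.
Proof. by move=> *; rewrite -[_ *: _]addr0 (dotP hH)// dot0r// addr0. Qed.

Lemma dotN x y : H x -> H y -> dot x (- y) = - dot x y.
Proof. by move=> *; rewrite -scaleN1r dotZ// mulN1r. Qed.

Lemma dotB x y z : H x -> H y -> H z -> dot x (y - z) = dot x y - dot x z.
Proof. by move=> *; rewrite dotD// ?dotN//; exact: HN. Qed.

Lemma dot0l x : H x -> dot 0 x = 0.
Proof. by move=> Hx; rewrite (dotC hH Hx H0) dot0r// conjc0. Qed.

Lemma rdotC x y : H x -> H y -> rd y x = rd x y.
Proof. by move=> Hx Hy; rewrite /rdot (dotC hH Hx Hy); case: (dot x y). Qed.

Lemma rdotD x y z : H x -> H y -> H z -> rd x (y + z) = rd x y + rd x z.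
Proof. by move=> *; rewrite /rdot dotD// ReD. Qed.

Lemma rdotZ (r : R) x y : H x -> H y -> rd x (r%:C%C *: y) = r * rd x y.
Proof. by move=> *; rewrite /rdot dotZ// ReM_real. Qed.

Lemma rdotN x y : H x -> H y -> rd x (- y) = - rd x y.
Proof. by move=> *; rewrite /rdot dotN//; case: (dot x y). Qed.

Lemma rdotNl x y : H x -> H y -> rd (- x) y = - rd x y.
Proof. by move=> *; rewrite rdotC// ?rdotN//; [rewrite (rdotC (x:=x))|exact: HN]. Qed.

Lemma nrm2_0 : n2 0 = 0.
Proof. by rewrite /nrm2 dot0r. Qed.

Lemma nrm2D x y : H x -> H y -> n2 (x + y) = n2 x + rd x y *+ 2 + n2 y.
Proof.
move=> Hx Hy; rewrite /nrm2 -/(rd _ _) rdotD//; last exact: HD.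
rewrite (rdotC Hx (HD Hx Hy)) (rdotC Hy (HD Hx Hy)) !rdotD//.
by rewrite (rdotC Hx Hy) /rdot mulr2n; lra.
Qed.

Lemma nrm2N x : H x -> n2 (- x) = n2 x.
Proof.
move=> Hx; rewrite /nrm2 -/(rd _ _) rdotN// ?rdotNl ?opprK//; exact: HN.
Qed.

Lemma nrm2B x y : H x -> H y -> n2 (x - y) = n2 x - rd x y *+ 2 + n2 y.
Proof. by move=> Hx Hy; rewrite nrm2D ?nrm2N ?rdotN ?mulNrn//; exact: HN. Qed.

Lemma nrm2BC x y : H x -> H y -> n2 (x - y) = n2 (y - x).
Proof. by move=> Hx Hy; rewrite -opprB nrm2N//; exact: HB. Qed.

Lemma nrm2Z a x : H x -> n2 (a *: x) = (complex.Re a ^+ 2 + complex.Im a ^+ 2) * n2 x.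
Proof.
move=> Hx; have HZx := HZ a Hx; rewrite /nrm2 dotZ//.
rewrite (dotC hH Hx HZx) dotZ//; case: a {HZx} => a b; case: (dot x x) => c d /=.
by ring.
Qed.

Lemma nrm2Zr (r : R) x : H x -> n2 (r%:C%C *: x) = r ^+ 2 * n2 x.
Proof. by move=> Hx; rewrite nrm2Z//= expr0n addr0. Qed.

(** Positivity of the squared norm of [n2 y *: x - rd x y *: y], divided by
    [n2 y]. *)
Lemma cauchy_schwarz x y : H x -> H y -> rd x y ^+ 2 <= n2 x * n2 y.
Proof.
move=> Hx Hy; have [y0|yN0] := eqVneq (n2 y) 0.
  by rewrite (nrm2_eq0 hH Hy y0) /rdot dot0r// nrm2_0 expr0n mulr0.
have y_gt0 : 0 < n2 y by rewrite lt_neqAle eq_sym yN0 (nrm2_ge0 hH).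
have : 0 <= n2 ((n2 y)%:C%C *: x - (rd x y)%:C%C *: y).
  by apply: (nrm2_ge0 hH); apply: HB; apply: HZ.
rewrite nrm2B ?nrm2Zr//; [|exact: HZ|exact: HZ].
rewrite rdotZ// ?(rdotC Hy) ?rdotZ//; [|exact: HZ|exact: HZ].
rewrite (rdotC Hx Hy) => h.
rewrite -(ler_pM2l y_gt0) -subr_ge0; move: h; congr (_ <= _).
by rewrite mulr2n; ring.
Qed.

Lemma nrm_ge0 x : 0 <= nm x. Proof. exact: sqrtr_ge0. Qed.

Lemma sqr_nrm x : H x -> nm x ^+ 2 = n2 x.
Proof. by move=> Hx; rewrite sqr_sqrtr// (nrm2_ge0 hH). Qed.

Lemma nrmD x y : H x -> H y -> nm (x + y) <= nm x + nm y.
Proof.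
move=> Hx Hy; rewrite -ler_sqr ?nnegrE ?addr_ge0 ?nrm_ge0//.
rewrite sqr_nrm; [|exact: HD]; rewrite nrm2D// sqrrD !sqr_nrm//.
rewrite lerD2r lerD2l -mulrnAl mulrnAl lerMn2r/=.
apply: le_trans (ler_norm _) _; rewrite -ler_sqr ?nnegrE ?mulr_ge0 ?nrm_ge0//.
by rewrite real_normK ?num_real// exprMn !sqr_nrm// cauchy_schwarz.
Qed.

Lemma nrmN x : H x -> nm (- x) = nm x.
Proof. by move=> Hx; rewrite /nrm nrm2N. Qed.

Lemma nrmB3 x y z : H x -> H y -> H z -> nm (x - z) <= nm (x - y) + nm (y - z).
Proof.
move=> Hx Hy Hz; rewrite (_ : x - z = (x - y) + (y - z)); last by rewrite subrKA.
by apply: nrmD; apply: HB.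
Qed.

Lemma nrmZr (r : R) x : H x -> nm (r%:C%C *: x) = `|r| * nm x.
Proof. by move=> Hx; rewrite /nrm nrm2Zr// sqrtrM ?sqr_ge0// sqrtr_sqr. Qed.

Lemma parallelogram x y : H x -> H y ->
  n2 (x + y) + n2 (x - y) = (n2 x + n2 y) *+ 2.
Proof. by move=> Hx Hy; rewrite nrm2D// nrm2B// mulr2n !mulr2n; ring. Qed.

(** The squared distance from [w] to [L]. *)
Definition dist2 L w : R := inf [set n2 (w - c) | c in L].

Section projection.
Variable L : set V.
Hypotheses (sL : submodule L) (LH : L `<=` H).

Lemma dist2_lb w : H w -> has_inf [set n2 (w - c) | c in L].
Proof.
move=> Hw; split; first by exists (n2 (w - 0)), 0 => //; exact: sL.1.
by exists 0 => _ [c /LH Hc <-]; apply: (nrm2_ge0 hH); exact: HB.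
Qed.

Lemma dist2_le w c : H w -> L c -> dist2 L w <= n2 (w - c).
Proof. by move=> Hw Lc; apply: ge_inf; [exact: (dist2_lb Hw).2|exists c]. Qed.

Lemma dist2_gt w a : H w -> dist2 L w < a -> exists2 c, L c & n2 (w - c) < a.
Proof.
by move=> Hw /inf_lt => /(_ (dist2_lb Hw).1) [_ [c Lc <-] ca]; exists c.
Qed.

(** A complex subspace contains [i k] with [k], and the real part of [dot (i k) g]
    is the imaginary part of [dot k g]. *)
Lemma perp_rdot k g : (forall k, L k -> rd k g = 0) -> H g -> L k -> dot k g = 0.
Proof.
move=> h Hg Lk; have Hk := LH Lk.
have r0 := h _ Lk; have := h _ (submoduleZ 'i%C sL Lk).
rewrite /rdot (dotC hH Hg (HZ _ Hk)) dotZ//.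
move: r0; rewrite /rdot (dotC hH Hg Hk); case: (dot g k) => a b /= -> hb /=.
suff -> : b = 0 by rewrite oppr0.
lra.
Qed.

(** The orthogonal complement of [L] is described through [L] itself: the
    projection of [w] on it is [w] minus the limit of a minimizing sequence of
    [L], and its squared norm is the squared distance from [w] to [L]. *)
Lemma proj_exists w : H w -> exists g, [/\ perp H dot L g,
  forall h, perp H dot L h -> dot h (w - g) = 0 & n2 g = dist2 L w].
Proof.
move=> Hw; set D := dist2 L w.
have D_le c : L c -> D <= n2 (w - c) by exact: dist2_le.
have /choice[u uP] : forall n, exists c, L c /\ n2 (w - c) < D + n.+1%:R^-1.
  move=> n; have : D < D + n.+1%:R^-1 by rewrite ltrDl invr_gt0.
  by move=> /(dist2_gt Hw)[c Lc cD]; exists c.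
have uL n := (uP n).1; have uH n := LH (uL n).
(* The parallelogram law at [w - u i] and [w - u j]: their half sum is [w]
   minus the midpoint, which lies in [L]. *)
have Lcauchy i j : n2 (u i - u j) <= (i.+1%:R^-1 + j.+1%:R^-1) *+ 2.
  have mL : L ((2^-1)%:C%C *: (u i + u j)).
    by apply: submoduleZ => //; apply: submoduleD.
  have := parallelogram (HB Hw (uH i)) (HB Hw (uH j)).
  rewrite (_ : w - u i - (w - u j) = - (u i - u j)); last first.
    by rewrite opprB addrC addrA subrK opprB.
  rewrite nrm2N; last exact: HB.
  have -> : w - u i + (w - u j) = 2%:C%C *: (w - (2^-1)%:C%C *: (u i + u j)).
    rewrite scalerBr scalerA -rmorphM/= mulfV// scale1r.
    by rewrite rmorph_nat scaler_nat mulr2n addrACA -opprD.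
  rewrite nrm2Zr; last by apply: HB => //; exact: LH.
  have := D_le _ mL; have := (uP i).2; have := (uP j).2.
  set p := n2 (w - _ *: _); set d := n2 (u i - u j); set a := n2 (w - u i).
  set b := n2 (w - u j); set s := i.+1%:R^-1; set t := j.+1%:R^-1.
  rewrite (_ : 2 ^+ 2 = 4); last by rewrite -natrX.
  clearbody p a b s t d D; lra.
have inv_small (e : R) : 0 < e -> exists N, forall i, (N <= i)%N -> i.+1%:R^-1 < e.
  move=> e0; have [N _ hN] := near_infty_natSinv_lt (PosNum e0).
  by exists N => i; exact: hN.
have [c Hc cP] : exists2 x, H x & forall e : R, 0 < e ->
    exists N, forall i, (N <= i)%N -> n2 (u i - x) < e.
  apply: (hilcomplete hH uH) => e e0.
  have [N hN] : exists N, forall i, (N <= i)%N -> i.+1%:R^-1 < e / 4.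
    by apply: inv_small; rewrite divr_gt0.
  exists N => i j /hN hi /hN hj; apply: le_lt_trans (Lcauchy i j) _.
  rewrite (_ : e = (e / 4 + e / 4) *+ 2); last by field.
  by rewrite ltr_pMn2r// ltrD.
have approx x e : H x -> 0 < e -> exists2 k, L k & `|rd x (c - k)| < e.
  move=> Hx e0; have q0 : 0 < e ^+ 2 / (n2 x + 1).
    by apply: divr_gt0; rewrite ?exprn_gt0// ltr_wpDl// (nrm2_ge0 hH).
  have [N hN] := cP _ q0; exists (u N) => //.
  rewrite -ltr_sqr ?nnegrE ?(ltW e0)//.
  have := hN N (leqnn N); rewrite real_normK ?num_real// nrm2BC// => h.
  apply: le_lt_trans (cauchy_schwarz Hx (HB Hc (uH N))) _.
  have x0 := nrm2_ge0 hH Hx; have x1 : 0 < n2 x + 1 by lra.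
  apply: (@le_lt_trans _ _ ((n2 x + 1) * n2 (c - u N))).
    by apply: ler_wpM2r; [apply: (nrm2_ge0 hH); exact: HB|lra].
  by rewrite mulrC -ltr_pdivlMr.
have Hg : H (w - c) by exact: HB.
have D0 : 0 <= D.
  apply: lb_le_inf; first exact: (dist2_lb Hw).1.
  by move=> _ [k /LH Hk <-]; apply: (nrm2_ge0 hH); exact: HB.
have close e : 0 < e -> exists N, nm (u N - c) <= e /\ N.+1%:R^-1 < e ^+ 2.
  move=> e0; have e20 : 0 < e ^+ 2 by rewrite exprn_gt0.
  have [N1 hN1] := cP _ e20; have [N2 hN2] := inv_small _ e20.
  exists (maxn N1 N2); split; last by rewrite hN2// leq_maxr.
  rewrite -ler_sqr ?nnegrE ?nrm_ge0 ?(ltW e0)// sqr_nrm; last exact: HB.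
  by rewrite ltW// hN1// leq_maxl.
(* The limit [c] need not lie in [L]; its minimality is inherited from the
   [u N] by the triangle inequality. *)
have lower k : L k -> D <= n2 (w - c - k).
  move=> Lk; have Hk := LH Lk; have Hgk : H (w - c - k) by exact: HB.
  rewrite -sqr_nrm// -[leLHS]sqr_sqrtr// ler_sqr ?nnegrE ?nrm_ge0 ?sqrtr_ge0//.
  apply/ler_addgt0Pr => e /close[N [Nc _]].
  have Huk : H (u N + k) by exact: HD.
  have Hck : H (c + k) by exact: HD.
  apply: (@le_trans _ _ (nm (w - (u N + k)))).
    rewrite -ler_sqr ?nnegrE ?nrm_ge0 ?sqrtr_ge0// sqr_sqrtr//.
    by rewrite sqr_nrm; [apply: D_le; exact: submoduleD|exact: HB].
  apply: le_trans (nrmB3 Hw Hck Huk) _.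
  rewrite [c + k - _](_ : _ = - (u N - c)); last first.
    by rewrite opprD opprB addrACA subrr addr0.
  by rewrite opprD addrA lerD2l nrmN//; exact: HB.
have nD : n2 (w - c) = D.
  apply/eqP; rewrite eq_le; apply/andP; split; last first.
    by have := lower 0 sL.1; rewrite subr0.
  rewrite -sqr_nrm// -[leRHS]sqr_sqrtr// ler_sqr ?nnegrE ?nrm_ge0 ?sqrtr_ge0//.
  apply/ler_addgt0Pr => e e0.
  have [N [Nc Ne]] := close (e / 2) (divr_gt0 e0 (ltr0n _ 2)).
  apply: le_trans (nrmB3 Hw (uH N) Hc) _.
  have h : nm (w - u N) <= Num.sqrt D + e / 2.
    rewrite -ler_sqr ?nnegrE ?nrm_ge0 ?addr_ge0 ?sqrtr_ge0 ?divr_ge0 ?(ltW e0)//.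
    rewrite sqr_nrm; last exact: HB.
    rewrite sqrrD sqr_sqrtr//; apply: le_trans (ltW (uP N).2) _.
    rewrite -addrA lerD2l; apply: le_trans (ltW Ne) _; rewrite lerDr.
    by rewrite mulrn_wge0// mulr_ge0 ?sqrtr_ge0// divr_ge0// ltW.
  lra.
(* Minimality against the multiple [a / (n2 k + 1)] of [k], where [a] is the
   scalar product with [k]; adding 1 avoids a division by zero. *)
have ortho k : L k -> rd k (w - c) = 0.
  move=> Lk; have Hk := LH Lk; set a := rd k _; have k0 := nrm2_ge0 hH Hk.
  have k1 : 0 < n2 k + 1 by lra.
  have := lower ((a / (n2 k + 1))%:C%C *: k) (submoduleZ _ sL Lk).
  have HaK := HZ (a / (n2 k + 1))%:C%C Hk.
  rewrite -nD (nrm2B Hg HaK) nrm2Zr ?rdotZ//.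
  rewrite (rdotC Hk Hg) -/a.
  set b := n2 k in k0 k1 *.
  rewrite -addrA -{1}[n2 _]addr0 lerD2l => h.
  have {}h : 0 <= (- (a ^+ 2 * (b + 2))) / (b + 1) ^+ 2.
    apply: le_trans h _; rewrite le_eqVlt; apply/orP; left; apply/eqP.
    by rewrite mulr2n; field; rewrite gt_eqF.
  have : 0 <= - (a ^+ 2 * (b + 2)).
    by move: h; rewrite pmulr_lge0// invr_gt0 exprn_gt0.
  rewrite oppr_ge0 pmulr_lle0; last by lra.
  by move=> a2; apply/eqP; rewrite -sqrf_eq0 eq_le a2 sqr_ge0.
exists (w - c); split => //; first by split=> // k Lk; exact: perp_rdot.
move=> h [Hh hL]; rewrite opprB addrC subrK.
suff hc : forall x, perp H dot L x -> rd x c = 0.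
  have r0 : rd h c = 0 by exact: hc.
  have i0 : rd ('i%C *: h) c = 0.
    apply: hc; split; first exact: HZ.
    by move=> k Lk; rewrite dotZ ?hL ?mulr0//; exact: LH.
  move: i0 r0; rewrite /rdot (dotC hH Hc (HZ _ Hh)) (dotC hH Hc Hh) dotZ//.
  case: (dot c h) => a b /= i0 ->.
  suff -> : b = 0 by rewrite oppr0.
lra.
move=> x [Hx xL]; apply/eqP; rewrite -normr_le0; apply/ler_addgt0Pr => e e0.
rewrite add0r; have [k Lk ke] := approx x e Hx e0.
have Hk := LH Lk; have : rd x k = 0 by rewrite rdotC// /rdot xL.
move=> xk; move: ke; rewrite rdotD//; last exact: HN.
by rewrite rdotN// xk subr0 => /ltW.
Qed.

Lemma proj_unique w g g' : H w -> perp H dot L g -> perp H dot L g' ->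
  (forall h, perp H dot L h -> dot h (w - g) = 0) ->
  (forall h, perp H dot L h -> dot h (w - g') = 0) -> g = g'.
Proof.
move=> Hw [Hg gL] [Hg' gL'] gP gP'.
have Pd : perp H dot L (g - g').
  by split; [exact: HB|move=> k Lk; rewrite dotB ?gL ?gL' ?subrr//; exact: LH].
apply/eqP; rewrite -subr_eq0; apply/eqP; apply: (nrm2_eq0 hH); first exact: Pd.1.
suff -> : nrm2 dot (g - g') = complex.Re (dot (g - g') (w - g') - dot (g - g') (w - g)).
  by rewrite gP ?gP'// subrr.
rewrite -dotB; [|exact: Pd.1|exact: HB|exact: HB].
by rewrite /nrm2 opprB [w - g' + _]addrC subrKA.
Qed.
End projection.

(** Only the values on [H] are meaningful, as for [orthproj]. *)
Definition projects G (P : V -> V) := forall w, H w ->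
  G (P w) /\ forall h, G h -> dot h (w - P w) = 0.

Section projector.
Variables (L : set V) (P : V -> V).
Hypotheses (sL : submodule L) (LH : L `<=` H) (PP : projects (perp H dot L) P).

Lemma projH w : H w -> H (P w).
Proof. by move=> /PP [[]]. Qed.

Lemma proj_dist2 w : H w -> n2 (P w) = dist2 L w.
Proof.
move=> Hw; have [g [gG gP <-]] := proj_exists sL LH Hw.
by have [PG PwP] := PP Hw; rewrite (proj_unique LH Hw gG PG gP PwP).
Qed.

Lemma proj_ZD (a : R[i]) x y : H x -> H y -> P (a *: x + y) = a *: P x + P y.
Proof.
move=> Hx Hy; have Hxy := hilP hH a Hx Hy.
have [[HPx LPx] Px] := PP Hx; have [[HPy LPy] Py] := PP Hy.
have [PG Pxy] := PP Hxy.
apply: (proj_unique LH Hxy PG) => //.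
  split; first exact: (hilP hH).
  by move=> k Lk; rewrite (dotP hH) ?LPx ?LPy ?mulr0 ?addr0//; exact: LH.
move=> h Gh; have Hh := Gh.1.
rewrite opprD addrACA -scalerBr (dotP hH)//; [|exact: HB|exact: HB].
by rewrite Px// Py// mulr0 addr0.
Qed.

Lemma projD x y : H x -> H y -> P (x + y) = P x + P y.
Proof. by move=> Hx Hy; rewrite -{1}[x]scale1r proj_ZD// scale1r. Qed.

Lemma projB x y : H x -> H y -> P (x - y) = P x - P y.
Proof. by move=> Hx Hy; rewrite addrC -scaleN1r proj_ZD// scaleN1r addrC. Qed.

Lemma projZ a x : H x -> P (a *: x) = a *: P x.
Proof.
move=> Hx; have P0 : P 0 = 0.
  by apply: (@addrI _ (P 0)); rewrite addr0 -projD// addr0.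
by rewrite -[a *: x]addr0 proj_ZD// P0 addr0.
Qed.

Lemma rdot_proj x w : H x -> H w -> rd x (P w) = rd (P x) (P w).
Proof.
move=> Hx Hw; have [PGx Px] := PP Hx; have [PGw _] := PP Hw.
have HPx := PGx.1; have HPw := PGw.1.
apply/eqP; rewrite (rdotC HPw Hx) (rdotC HPw HPx) -subr_eq0 -rdotN// -rdotD//.
  by rewrite /rdot Px.
exact: HN.
Qed.

(** The projection is a self-adjoint idempotent, so its scalar products are
    polarizations of the squared norms of its values. *)
Lemma proj_polar x w : H x -> H w ->
  rd x (P w) = (n2 (P (x + w)) - n2 (P (x - w))) / 4.
Proof.
move=> Hx Hw; have HPx := projH Hx; have HPw := projH Hw.
by rewrite rdot_proj// projD// projB// nrm2D// nrm2B//; field.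
Qed.

Lemma proj_nrm2_le w : H w -> n2 (P w) <= n2 w.
Proof.
by move=> Hw; rewrite proj_dist2//; have := dist2_le sL LH Hw sL.1; rewrite subr0.
Qed.

Lemma proj_nrm_le w : H w -> nm (P w) <= nm w.
Proof. by move=> Hw; rewrite ler_wsqrtr// proj_nrm2_le. Qed.
End projector.

Definition gap (P1 P2 : V -> V) : R :=
  sup [set nm (P1 w - P2 w) | w in [set w | H w /\ nm w <= 1]].

Lemma gap_has_sup L1 L2 P1 P2 :
  submodule L1 -> L1 `<=` H -> submodule L2 -> L2 `<=` H ->
  projects (perp H dot L1) P1 -> projects (perp H dot L2) P2 ->
  has_sup [set nm (P1 w - P2 w) | w in [set w | H w /\ nm w <= 1]].
Proof.
move=> sL1 LH1 sL2 LH2 PP1 PP2; split.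
  exists (nm (P1 0 - P2 0)), 0 => //; split=> //.
  by rewrite /nrm nrm2_0 sqrtr0.
exists 2 => _ [w [Hw w1] <-].
have H1 := projH PP1 Hw; have H2 := projH PP2 Hw.
have := proj_nrm_le sL1 LH1 PP1 Hw; have := proj_nrm_le sL2 LH2 PP2 Hw.
by have := nrmD H1 (HN H2); rewrite nrmN//; lra.
Qed.

Lemma gap_ge0 L1 L2 P1 P2 :
  submodule L1 -> L1 `<=` H -> submodule L2 -> L2 `<=` H ->
  projects (perp H dot L1) P1 -> projects (perp H dot L2) P2 -> 0 <= gap P1 P2.
Proof.
move=> sL1 LH1 sL2 LH2 PP1 PP2.
have [_ ub] := gap_has_sup sL1 LH1 sL2 LH2 PP1 PP2.
apply: le_trans (nrm_ge0 (P1 0 - P2 0)) _; apply: ub_le_sup => //.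
by exists 0 => //; split=> //; rewrite /nrm nrm2_0 sqrtr0.
Qed.

Lemma gap_le2 L1 L2 P1 P2 :
  submodule L1 -> L1 `<=` H -> submodule L2 -> L2 `<=` H ->
  projects (perp H dot L1) P1 -> projects (perp H dot L2) P2 -> gap P1 P2 <= 2.
Proof.
move=> sL1 LH1 sL2 LH2 PP1 PP2; apply: ge_sup.
  exact: (gap_has_sup sL1 LH1 sL2 LH2 PP1 PP2).1.
move=> _ [w [Hw w1] <-].
have H1 := projH PP1 Hw; have H2 := projH PP2 Hw.
have := proj_nrm_le sL1 LH1 PP1 Hw; have := proj_nrm_le sL2 LH2 PP2 Hw.
by have := nrmD H1 (HN H2); rewrite nrmN//; lra.
Qed.

Lemma gap_sym P1 P2 : (forall w, H w -> H (P1 w)) -> (forall w, H w -> H (P2 w)) ->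
  gap P1 P2 = gap P2 P1.
Proof.
move=> H1 H2; rewrite /gap; congr sup; apply/seteqP; split => _ [w [Hw w1] <-];
by exists w => //; rewrite -opprB nrmN//; apply: HB; auto.
Qed.

Lemma gap_triangle L1 L2 L3 P1 P2 P3 :
  submodule L1 -> L1 `<=` H -> submodule L2 -> L2 `<=` H ->
  submodule L3 -> L3 `<=` H ->
  projects (perp H dot L1) P1 -> projects (perp H dot L2) P2 ->
  projects (perp H dot L3) P3 -> gap P1 P3 <= gap P1 P2 + gap P2 P3.
Proof.
move=> sL1 LH1 sL2 LH2 sL3 LH3 PP1 PP2 PP3.
apply: ge_sup; first exact: (gap_has_sup sL1 LH1 sL3 LH3 PP1 PP3).1.
move=> _ [w [Hw w1] <-].
have H1 := projH PP1 Hw; have H2 := projH PP2 Hw; have H3 := projH PP3 Hw.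
apply: le_trans (nrmB3 H1 H2 H3) _; apply: lerD; apply: ub_le_sup.
- exact: (gap_has_sup sL1 LH1 sL2 LH2 PP1 PP2).2.
- by exists w.
- exact: (gap_has_sup sL2 LH2 sL3 LH3 PP2 PP3).2.
- by exists w.
Qed.

(** Homogeneity turns the supremum over the unit ball into a condition on [w]
    that is open, and may therefore be tested on a dense set. *)
Lemma gap_gtP L1 L2 P1 P2 (D : set V) (a : R) : 0 <= a ->
  submodule L1 -> L1 `<=` H -> submodule L2 -> L2 `<=` H ->
  projects (perp H dot L1) P1 -> projects (perp H dot L2) P2 ->
  D `<=` H -> (forall x e, H x -> 0 < e -> exists2 y, D y & nm (x - y) < e) ->
  a < gap P1 P2 <-> exists2 w, D w & a ^+ 2 * n2 w < n2 (P1 w - P2 w).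
Proof.
move=> a0 sL1 LH1 sL2 LH2 PP1 PP2 DH Ddense.
have hs := gap_has_sup sL1 LH1 sL2 LH2 PP1 PP2.
have HT w : H w -> H (P1 w - P2 w).
  by move=> Hw; apply: HB; [exact: (projH PP1 Hw)|exact: (projH PP2 Hw)].
have sq w : H w -> (a * nm w < nm (P1 w - P2 w)) = (a ^+ 2 * n2 w < n2 (P1 w - P2 w)).
  move=> Hw; rewrite -ltr_sqr ?nnegrE ?mulr_ge0 ?nrm_ge0//.
  by rewrite exprMn !sqr_nrm//; exact: HT.
split.
  move=> /sup_gt[//|_ [w [Hw w1] <-] aw]; first exact: hs.1.
  set d := nm (P1 w - P2 w) - a.
  have d0 : 0 < d by rewrite subr_gt0.
  (* Passing from [w] to [y] costs at most [(a + 2) * nm (w - y)]. *)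
  have e0 : 0 < d / (a + 3) by apply: divr_gt0 => //; lra.
  have [y Dy wy] := Ddense w _ Hw e0; have Hy := DH y Dy.
  exists y => //; rewrite -sq//.
  have Hwy : H (w - y) by exact: HB.
  have n1 : nm (P1 w - P2 w) <= nm (P1 y - P2 y) + nm (w - y) *+ 2.
    have -> : P1 w - P2 w = (P1 y - P2 y) + (P1 (w - y) - P2 (w - y)).
      rewrite (projB LH1 PP1)// (projB LH2 PP2)//.
      move: (P1 w) (P2 w) (P1 y) (P2 y) => a1 a2 b1 b2.
      by rewrite opprB addrACA [b1 + _]addrC subrK addKr.
    apply: le_trans (nrmD (HT _ Hy) (HT _ Hwy)) _; rewrite lerD2l.
    have H1 := projH PP1 Hwy; have H2 := projH PP2 Hwy.
    have := proj_nrm_le sL1 LH1 PP1 Hwy; have := proj_nrm_le sL2 LH2 PP2 Hwy.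
    by have := nrmD H1 (HN H2); rewrite nrmN//; lra.
  have n3 : nm y <= 1 + nm (w - y).
    rewrite -{1}[y](subKr w); apply: le_trans (nrmD Hw (HN Hwy)) _.
    by rewrite nrmN// lerD2r.
  have n4 : a * nm y <= a * (1 + nm (w - y)) by exact: ler_wpM2l.
  have n5 : (a + 3) * nm (w - y) < d.
    by rewrite mulrC -ltr_pdivlMr//; lra.
  have n6 := nrm_ge0 (w - y).
  move: n1 n4 n5; rewrite /d; set p := nm (w - y) in n6 *.
  move: (nm (P1 w - P2 w)) (nm (P1 y - P2 y)) => s t; rewrite mulrDr mulrDl mulr1; lra.
move=> [w /DH Hw]; rewrite -sq// => aw.
have w0 : 0 < nm w.
  rewrite lt_neqAle nrm_ge0 andbT; apply/eqP => w0.
  have : nm (P1 w - P2 w) <= nm w *+ 2.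
    have H1 := projH PP1 Hw; have H2 := projH PP2 Hw.
    have := proj_nrm_le sL1 LH1 PP1 Hw; have := proj_nrm_le sL2 LH2 PP2 Hw.
    by have := nrmD H1 (HN H2); rewrite nrmN//; lra.
  by move: aw; rewrite -w0 mulr0 mul0rn => /lt_le_trans /[apply]; rewrite ltxx.
have HZw := HZ ((nm w)^-1)%:C%C Hw.
have nZw : nm (((nm w)^-1)%:C%C *: w) = 1.
  by rewrite nrmZr// ger0_norm ?invr_ge0 ?nrm_ge0// mulVf// gt_eqF.
apply: lt_le_trans (ub_le_sup hs.2 _); last first.
  by exists (((nm w)^-1)%:C%C *: w) => //; split=> //; rewrite nZw.
rewrite (projZ LH1 PP1)// (projZ LH2 PP2)// -scalerBr nrmZr; last exact: HT.
by rewrite ger0_norm ?invr_ge0 ?nrm_ge0// mulrC ltr_pdivlMr.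
Qed.
End Theory.
End Hilbert.

(** * Square-integrable functions *)

Section L2.
Context d (T : measurableType d) (R : realType) (mu : {measure set T -> \bar R}).
Implicit Types f g h : T -> R.

Lemma ae_imp (P Q : T -> Prop) : (forall t, P t -> Q t) ->
  {ae mu, forall t, P t} -> {ae mu, forall t, Q t}.
Proof. by move=> PQ; apply: filterS => t; exact: PQ. Qed.

Lemma ae_imp2 (P Q S : T -> Prop) : (forall t, P t -> Q t -> S t) ->
  {ae mu, forall t, P t} -> {ae mu, forall t, Q t} -> {ae mu, forall t, S t}.
Proof. by move=> PQS; apply: filterS2 => t; exact: PQS. Qed.

Lemma ae_finite (I : finType) (P : I -> T -> Prop) :
  (forall i, {ae mu, forall t, P i t}) -> {ae mu, forall t i, P i t}.
Proof. by move=> h; apply: filter_forall. Qed.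

Definition L1 f := mu.-integrable setT (EFin \o f).

Lemma L1_measurable f : L1 f -> measurable_fun setT f.
Proof. by move=> /measurable_int /measurable_EFinP. Qed.

Lemma L1D f g : L1 f -> L1 g -> L1 (fun t => f t + g t).
Proof. by move=> fi gi; have := integrableD measurableT fi gi. Qed.

Lemma L1Z (c : R) f : L1 f -> L1 (fun t => c * f t).
Proof. by move=> fi; have := integrableZl measurableT c fi. Qed.

Lemma L1N f : L1 f -> L1 (fun t => - f t).
Proof. by move=> /(L1Z (-1)); under eq_fun do rewrite mulN1r. Qed.

Lemma L1B f g : L1 f -> L1 g -> L1 (fun t => f t - g t).
Proof. by move=> fi gi; apply: L1D => //; exact: L1N. Qed.

Lemma L1_0 : L1 (fun=> 0). Proof. exact: integrable0. Qed.

Lemma L1_le f g : measurable_fun setT f -> (forall t, `|f t| <= g t) ->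
  L1 g -> L1 f.
Proof.
move=> mf fg; apply: le_integrable => //; first exact/measurable_EFinP.
by move=> t _; rewrite lee_fin (le_trans (fg t))// ler_norm.
Qed.

Lemma L1_sum (I : Type) (s : seq I) (F : I -> T -> R) :
  (forall i, L1 (F i)) -> L1 (fun t => \sum_(i <- s) F i t).
Proof.
move=> FL; elim: s => [|i s IH].
  by under eq_fun do rewrite big_nil; exact: L1_0.
by under eq_fun do rewrite big_cons; apply: L1D.
Qed.

Lemma ae_Rintegral f g : measurable_fun setT f -> measurable_fun setT g ->
  {ae mu, forall t, f t = g t} -> \int[mu]_t f t = \int[mu]_t g t.
Proof.
move=> mf mg fg; rewrite /Rintegral; congr fine; apply: ae_eq_integral => //.
- exact/measurable_EFinP.
- exact/measurable_EFinP.
- by apply: filterS fg => t /= -> _.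
Qed.

Lemma Rintegral_eq0 f : L1 f -> (forall t, 0 <= f t) -> \int[mu]_t f t = 0 ->
  {ae mu, forall t, f t = 0}.
Proof.
move=> fi f0 If; have mf := measurable_int _ fi.
suff : ae_eq mu setT (EFin \o f) (cst 0%E).
  by apply: filterS => t /= /(_ I) [].
apply/(ae_eq_integral_abs mu measurableT mf).
rewrite (eq_integral (EFin \o f)); last by move=> t _ /=; rewrite ger0_norm.
by rewrite -[LHS]fineK; [congr EFin|exact: integrable_fin_num].
Qed.

Definition sq f := measurable_fun setT f /\ L1 (fun t => f t ^+ 2).

Lemma sqM f g : sq f -> sq g -> L1 (fun t => f t * g t).
Proof.
move=> [mf fi] [mg gi]; apply: (L1_le _ _ (L1D fi gi)).
  exact: measurable_funM.
move=> t; have := sqr_ge0 (f t + g t); have := sqr_ge0 (f t - g t).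
rewrite sqrrB sqrrD => h1 h2; rewrite ler_norml; apply/andP; split; lra.
Qed.

Lemma sq_le f g : measurable_fun setT f -> (forall t, `|f t| <= `|g t|) ->
  sq g -> sq f.
Proof.
move=> mf fg [mg gi]; split=> //; apply: L1_le gi; first exact: measurable_funX.
move=> t; rewrite ger0_norm ?sqr_ge0//.
by rewrite -[f t ^+ 2]real_normK ?num_real// -[g t ^+ 2]real_normK ?num_real// ler_sqr ?nnegrE.
Qed.

Lemma sqZ c f : sq f -> sq (fun t => c * f t).
Proof.
move=> [mf fi]; split; first exact: measurable_funM.
by under eq_fun do rewrite exprMn; apply: L1Z.
Qed.

Lemma sqD f g : sq f -> sq g -> sq (fun t => f t + g t).
Proof.
move=> sf sg; have [[mf fi] [mg gi]] := (sf, sg); split.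
  exact: measurable_funD.
under eq_fun do rewrite sqrrD; apply: L1D => //; apply: L1D => //.
under eq_fun do rewrite -mulr_natl; apply: L1Z; exact: sqM.
Qed.

Lemma sqB f g : sq f -> sq g -> sq (fun t => f t - g t).
Proof.
move=> sf sg; apply: sqD => //.
by under eq_fun do rewrite -mulN1r; apply: sqZ.
Qed.

Lemma sq0 : sq (fun=> 0).
Proof. by split=> //; under eq_fun do rewrite expr0n/=; exact: L1_0. Qed.

Lemma sq_integralE f : sq f ->
  (\int[mu]_t (f t ^+ 2)%:E = (\int[mu]_t f t ^+ 2)%:E)%E.
Proof. by move=> [_ fi]; rewrite /Rintegral fineK//; exact: integrable_fin_num. Qed.

Section complete.
Variable u : nat -> T -> R.
Hypothesis su : forall n, sq (u n).
Hypothesis cu : forall e : R, 0 < e -> exists N, forall i j, (N <= i)%N ->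
  (N <= j)%N -> \int[mu]_t (u i t - u j t) ^+ 2 < e.

(** [phi k] is a rank after which the squared distances stay below [e k]; the
    weights [4 ^ k] still leave the [e k] summable. *)
Lemma fast_subsequence : exists phi : nat -> nat, exists e : nat -> R,
  [/\ forall k, 0 < e k, forall k, (k <= phi k)%N,
     forall k i j, (phi k <= i)%N -> (phi k <= j)%N ->
        \int[mu]_t (u i t - u j t) ^+ 2 < e k,
     forall k, (phi k <= phi k.+1)%N
   & forall k, 4 ^+ k * e k = 1 / (2 ^ k.+1)%:R].
Proof.
pose e k : R := 4 ^- k * (1 / (2 ^ k.+1)%:R).
have e0 k : 0 < e k.
  by rewrite mulr_gt0 ?invr_gt0 ?exprn_gt0// divr_gt0// ltr0n expn_gt0.
have /choice[N NP] k := cu (e0 k).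
pose phi := fix phi k := if k is k'.+1 then maxn (phi k') (maxn (N k) k) else N 0%N.
have phiN k : (N k <= phi k)%N.
  by case: k => //= k; rewrite !leq_max leqnn orbT.
exists phi, e; split => //.
- by case=> //= k; rewrite !leq_max leqnn !orbT.
- by move=> k i j hi hj; apply: NP; exact: leq_trans (phiN k) _.
- by move=> k /=; rewrite leq_max leqnn.
- by move=> k; rewrite /e mulVKf// expf_neq0.
Qed.

(** The sum of the squared increments weighted by [4 ^ k] has finite integral,
    hence is finite almost everywhere; there the increments are bounded by a
    geometric sequence of ratio 1/2. *)
Lemma subsequence_ae_cvg (g : nat -> T -> R) (e : nat -> R) :
  (forall k, sq (g k)) ->
  (forall k, \int[mu]_t (g k.+1 t - g k t) ^+ 2 < e k) ->
  (forall k, 4 ^+ k * e k = 1 / (2 ^ k.+1)%:R) ->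
  exists A, [/\ measurable A, {ae mu, forall t, A t} &
    forall t, A t -> cvgn (fun k => g k t)].
Proof.
move=> sg ge eE.
pose D k t := (g k.+1 t - g k t) ^+ 2.
have sD k : sq (fun t => g k.+1 t - g k t) by exact: sqB.
pose w k t : \bar R := ((4 ^+ k)%:E * (D k t)%:E)%E.
have mw k : measurable_fun setT (w k).
  apply: measurable_funeM; apply/measurable_EFinP.
  by apply: measurable_funX; exact: (sD k).1.
have w0 k t : (0 <= w k t)%E.
  by apply: mule_ge0; rewrite lee_fin; [exact: exprn_ge0|exact: sqr_ge0].
pose G t := (\sum_(k <oo) w k t)%E.
have IG : (\int[mu]_t G t < +oo)%E.
  rewrite integral_nneseries//; apply: (@le_lt_trans _ _ 1%:E); last by rewrite ltry.
  apply: le_trans (epsilon_trick0 xpredT ler01); apply: lee_nneseries => [k _ _|k _].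
    by apply: integral_ge0.
  have mDk : measurable_fun setT (fun t => (D k t)%:E).
    by apply/measurable_EFinP; apply: measurable_funX; exact: (sD k).1.
  have Dk0 t : setT t -> (0 <= (D k t)%:E)%E by rewrite lee_fin /D sqr_ge0.
  have wk0 : (0 <= (4 ^+ k : R)%:E)%E by rewrite lee_fin exprn_ge0.
  rewrite (ge0_integralZl mu measurableT mDk Dk0 wk0).
  by rewrite sq_integralE// -eE -EFinM lee_fin ler_pM2l ?exprn_gt0// ltW.
have G0 t : (0 <= G t)%E by apply: nneseries_ge0.
have mG : measurable_fun setT G.
  by apply: ge0_emeasurable_sum.
have iG : mu.-integrable setT G.
  apply/integrableP; split=> //.
  by under eq_integral do rewrite gee0_abs//.
exists [set t | G t \is a fin_num]; split.
- by rewrite -[X in measurable X]setTI; exact: emeasurable_fin_num.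
- by apply: filterS (integrable_ae measurableT iG) => t /(_ I).
move=> t /= Gt; set M := fine (G t).
have M0 : 0 <= M by exact: fine_ge0.
have DM k : 4 ^+ k * D k t <= M.
  rewrite -lee_fin fineK//; apply: le_trans (nneseries_lim_ge k.+1 _) => //.
  by rewrite big_mkord big_ord_recr/= leeDr//; apply: sume_ge0.
suff : cvgn (series (telescope (fun k => g k t))).
  rewrite telescopeK => h; rewrite (_ : (fun k => g k t) =
    (fun k => (g k t - g 0%N t) + g 0%N t)); last by apply/funext => k; rewrite subrK.
  by apply: is_cvgD => //; exact: is_cvg_cst.
apply: normed_cvg.
apply: (@series_le_cvg _ _ (geometric (Num.sqrt M) (2^-1))) => //.
- by move=> k /=; exact: normr_ge0.
- by move=> k /=; rewrite mulr_ge0 ?sqrtr_ge0// exprn_ge0// invr_ge0.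
- move=> k /=; rewrite -ler_sqr ?nnegrE ?mulr_ge0 ?sqrtr_ge0 ?exprn_ge0 ?invr_ge0//.
  rewrite real_normK ?num_real// exprMn sqr_sqrtr//.
  have -> : ((2^-1 : R) ^+ k) ^+ 2 = (4 ^+ k)^-1.
    by rewrite -exprM mulnC exprM exprVn -natrX exprVn.
  by rewrite ler_pdivlMr ?exprn_gt0// mulrC; exact: DM.
- apply: is_cvg_geometric_series; rewrite ger0_norm ?invr_ge0//.
  by rewrite invf_lt1// ltr1n.
Qed.

(** The Riesz-Fischer theorem: along a fast subsequence there is a limit almost
    everywhere, and Fatou's lemma turns it into a limit in mean square.  The
    second clause makes limits of causal signals causal. *)
Lemma L2_complete : exists f, [/\ sq f,
  forall t, (forall n, u n t = 0) -> f t = 0 &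
  forall e : R, 0 < e -> exists N, forall i, (N <= i)%N ->
    \int[mu]_t (u i t - f t) ^+ 2 < e].
Proof.
have [phi [e [e0 phik phiP phiS eE]]] := fast_subsequence.
pose g k := u (phi k).
have sg k : sq (g k) by exact: su.
have [|A [mA aeA Acvg]] := @subsequence_ae_cvg g e sg _ eE.
  by move=> k; apply: phiP.
pose g' k t := g k t * \1_A t.
have mg' k : measurable_fun setT (g' k).
  by apply: measurable_funM; [exact: (sg k).1|exact: measurable_indic].
have g'cvg t : cvgn (fun k => g' k t).
  rewrite /g' /indic; case: (boolP (t \in A)) => tA /=.
    under eq_fun do rewrite mulr1; apply: Acvg; exact: set_mem.
  by under eq_fun do rewrite mulr0; exact: is_cvg_cst.
pose f t := limn (fun k => g' k t).
have g'f t : (fun k => g' k t) @ \oo --> f t by exact: g'cvg.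
have mf : measurable_fun setT f by apply: (measurable_fun_cvg mg') => t _; exact: g'f.
have close k i : (phi k <= i)%N ->
    (\int[mu]_t ((u i t - f t) ^+ 2)%:E <= (e k)%:E)%E.
  move=> ki.
  pose h j t := (((u i t - g' (k + j)%N t) ^+ 2)%:E).
  have mh j : measurable_fun setT (h j).
    apply/measurable_EFinP; apply: measurable_funX; apply: measurable_funB => //.
    exact: (su i).1.
  have h0 j t : setT t -> (0 <= h j t)%E by rewrite lee_fin sqr_ge0.
  have hcvg t : (h ^~ t) @ \oo --> ((u i t - f t) ^+ 2)%:E.
    apply: cvg_EFin; first exact: nearW.
    have : (fun j => u i t - g' (k + j)%N t) @ \oo --> u i t - f t.
      apply: cvgB; first exact: cvg_cst.
      have := g'f t; rewrite -(cvg_shiftn k) /=.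
      by under eq_fun do rewrite addnC.
    move=> c; exact: (cvgM c c).
  rewrite (eq_integral (fun t => limn_einf (h ^~ t))); last first.
    by move=> t _; rewrite (cvg_limn_einf_sup (hcvg t)).1.
  apply: le_trans (fatou mu measurableT mh h0) _.
  rewrite limn_einf_lim; apply: lime_le; first exact: is_cvg_einfs.
  apply: nearW => j; apply: le_trans (_ : (\int[mu]_t h j t <= _)%E).
    by apply: ereal_inf_lbound; exists j => //=.
  rewrite (@ge0_ae_eq_integral _ _ _ mu setT _ (fun t => ((u i t - g (k + j)%N t) ^+ 2)%:E))//.
  - rewrite sq_integralE; last exact: sqB.
    rewrite lee_fin ltW// phiP//; elim: j => [|j IH]; first by rewrite addn0.
    by rewrite addnS (leq_trans IH)// phiS.
  - apply/measurable_EFinP; apply: measurable_funX.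
    by apply: measurable_funB; [exact: (su i).1|exact: (sg _).1].
  - by move=> t _; rewrite lee_fin sqr_ge0.
  - by move=> t _; rewrite lee_fin sqr_ge0.
  - by apply: filterS aeA => t At _; rewrite /h /g' /indic mem_set// mulr1.
have sif k i : (phi k <= i)%N -> sq (fun t => u i t - f t).
  move=> ki; split.
    by apply: measurable_funB => //; exact: (su i).1.
  apply/integrableP; split.
    apply/measurable_EFinP; apply: measurable_funX.
    by apply: measurable_funB => //; exact: (su i).1.
  apply: le_lt_trans (_ : ((e k)%:E < +oo)%E); last by rewrite ltry.
  apply: le_trans (close k i ki); rewrite le_eqVlt; apply/orP; left; apply/eqP.
  by apply: eq_integral => t _ /=; rewrite ger0_norm// sqr_ge0.
exists f; split.
- rewrite (_ : f = (fun t => u (phi 0%N) t - (u (phi 0%N) t - f t))).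
    by apply: sqB => //; exact: (sif 0%N).
  by apply/funext => t; rewrite subKr.
- move=> t ut; rewrite /f (_ : (fun k => _) = cst 0) ?lim_cst//.
  by apply/funext => k; rewrite /g' /g ut mul0r.
move=> r r0.
have [k kr] : exists k, e k < r.
  have [N _ hN] := near_infty_natSinv_lt (PosNum r0).
  exists N; apply: le_lt_trans (hN N (leqnn _)).
  have := eE N => /(congr1 (fun x => 4 ^- N * x)).
  rewrite mulKf ?expf_neq0// => ->; rewrite mul1r.
  apply: (@le_trans _ _ (1 * (2 ^ N.+1)%:R^-1)).
    apply: ler_wpM2r; first by rewrite invr_ge0.
    by rewrite invf_le1 ?exprn_gt0// exprn_ege1// ler1n.
  by rewrite mul1r lef_pV2 ?posrE ?ltr0n ?expn_gt0// ler_nat ltnW// ltn_expl.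
exists (phi k) => i ki; apply: le_lt_trans kr.
by rewrite -lee_fin -sq_integralE ?close//; exact: sif ki.
Qed.
End complete.
End L2.

(** * Functions on the half-line with vanishing exponential moments *)

Section Laplace.
Context {R : realType}.
Notation mu := (@lebesgue_measure R).
Implicit Types (f g h : R -> R) (s t c r : R).

Lemma measurable_expRM r : measurable_fun setT (fun t : R => expR (- (r * t))).
Proof.
apply: measurableT_comp => //=; apply: measurable_funN; exact: measurable_funM.
Qed.

(** A polynomial in [e^(-t)] that tends to the indicator of [t > c] as [N] grows:
    the exponent is about [e^(N c)], to be compared with [e^(-N t)]. *)
Definition tail_step c (N : nat) t : R :=
  (1 - expR (- (N%:R * t))) ^+ Num.truncn (expR (N%:R * c)).

Lemma tail_step01 c N t : 0 <= t -> 0 <= tail_step c N t <= 1.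
Proof.
move=> t0; have e1 : expR (- (N%:R * t)) <= 1.
  by rewrite -[leRHS]expR0 ler_expR oppr_le0 mulr_ge0.
have e0 := expR_ge0 (- (N%:R * t)).
by rewrite exprn_ge0 ?exprn_ile1 ?subr_ge0// gerBl.
Qed.

Lemma bernoulli_ineq (y : R) M : 0 <= y <= 1 -> 1 - M%:R * y <= (1 - y) ^+ M.
Proof.
move=> /andP[y0 y1]; elim: M => [|M IH]; first by rewrite mul0r subr0.
rewrite exprS; apply: (@le_trans _ _ ((1 - y) * (1 - M%:R * y))).
  rewrite -natr1 -subr_ge0 [X in 0 <= X](_ : _ = M%:R * y ^+ 2); last by ring.
  by rewrite mulr_ge0// sqr_ge0.
by apply: ler_wpM2l => //; rewrite subr_ge0.
Qed.

(** For [c < t] this is Bernoulli's inequality, for [t <= c] the bound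
    [1 - y <= e^(-y)]; [e^(-x) <= 1 / (1 + x)] then bounds both errors. *)
Lemma tail_step_close c N t : 0 <= t -> 0 <= c ->
  `|tail_step c N t - (c < t)%R%:R| <= (1 + N%:R * `|t - c|)^-1.
Proof.
move=> t0 c0; have /andP[s0 s1] := tail_step01 c N t0.
set y := expR (- (N%:R * t)).
have y0 : 0 < y by exact: expR_gt0.
have y1 : y <= 1 by rewrite -[leRHS]expR0 ler_expR oppr_le0 mulr_ge0.
rewrite /tail_step -/y in s0 s1 *.
set K := expR (N%:R * c); set M := Num.truncn K.
have [MK KM] : M%:R <= K /\ K < M.+1%:R.
  by have /andP[] := @truncn_itv _ K (expR_ge0 _).
have Ky : K * y = expR (N%:R * (c - t)) by rewrite -expRD -mulrBr.
have inv_exp (x : R) : 0 <= x -> expR (- x) <= (1 + x)^-1.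
  move=> x0; rewrite expRN lef_pV2 ?posrE ?expR_gt0 ?expR_ge1Dx//.
  by rewrite ltr_pwDl.
have [ct|tc] := ltP c t.
  rewrite ler0_norm ?subr_le0// opprB.
  apply: (@le_trans _ _ (M%:R * y)).
    by rewrite lerBlDr addrC -lerBlDr bernoulli_ineq// y1 ltW.
  apply: (@le_trans _ _ (K * y)); first by rewrite ler_pM2r.
  have -> : `|t - c| = t - c by rewrite ger0_norm// subr_ge0 ltW.
  rewrite Ky -opprB mulrN.
  by apply: inv_exp; rewrite mulr_ge0// subr_ge0 ltW.
have -> : `|t - c| = c - t by rewrite ler0_norm ?subr_le0// opprB.
rewrite subr0 ger0_norm//.
apply: (@le_trans _ _ (expR (- (M%:R * y)))).
  rewrite mulrC -mulNr expRM_natr; apply: lerXn2r; rewrite ?nnegrE ?subr_ge0 ?expR_ge0//.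
  exact: expR_ge1Dx.
apply: le_trans (inv_exp _ _) _; first by rewrite mulr_ge0// ltW.
rewrite lef_pV2 ?posrE; last 2 first.
- by rewrite ltr_pwDl// mulr_ge0// ltW.
- by rewrite ltr_pwDl// mulr_ge0// subr_ge0.
have h : (K - 1) * y <= M%:R * y.
  by rewrite ler_pM2r// lerBlDr natr1 ltW.
rewrite lerD2l; apply: le_trans h; rewrite mulrBl mul1r Ky.
by have := expR_ge1Dx (N%:R * (c - t)); lra.
Qed.

Section moments.
Variable h : R -> R.
Hypotheses (ih : L1 mu h) (h0 : forall t, t < 0 -> h t = 0).
Hypothesis moments0 : forall n : nat, \int[mu]_t (expR (- (n%:R * t)) * h t) = 0.

Lemma L1_expM r : 0 <= r -> L1 mu (fun t => expR (- (r * t)) * h t).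
Proof.
move=> r0; have ih' := integrable_norm ih.
have mh := L1_measurable ih; have me := measurable_expRM r.
apply: L1_le ih'; first exact: measurable_funM.
move=> t; have [t0|t0] := ltP t 0; first by rewrite /= (h0 t0) mulr0.
rewrite normrM -[leRHS]mul1r; apply: ler_wpM2r => //.
by rewrite ger0_norm ?expR_ge0// -[leRHS]expR0 ler_expR oppr_le0 mulr_ge0.
Qed.

Lemma poly_moment (p : {poly R}) n :
  L1 mu (fun t => p.[expR (- t)] * (expR (- (n%:R * t)) * h t)) /\
  \int[mu]_t (p.[expR (- t)] * (expR (- (n%:R * t)) * h t)) = 0.
Proof.
elim/poly_ind: p n => [|p c IH] n.
  under eq_fun do rewrite horner0 mul0r.
  by split; [exact: L1_0|rewrite Rintegral_cst// mul0r].
have E t : ('X * p + c%:P).[expR (- t)] * (expR (- (n%:R * t)) * h t) =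
    p.[expR (- t)] * (expR (- (n.+1%:R * t)) * h t) + c * (expR (- (n%:R * t)) * h t).
  have -> : expR (- (n.+1%:R * t)) = expR (- t) * expR (- (n%:R * t)).
    by rewrite -expRD -natr1; congr expR; ring.
  by rewrite hornerD hornerM hornerX hornerC; ring.
rewrite [p * 'X]mulrC.
under eq_fun do rewrite E.
have [L I0] := IH n.+1; have Ln := L1_expM (ler0n R n).
split; first by apply: L1D => //; apply: L1Z.
by rewrite RintegralD//; [rewrite I0 RintegralZl// moments0 mulr0 addr0|exact: L1Z].
Qed.

Lemma tail_step_moment c N : L1 mu (fun t => tail_step c N t * h t) /\
  \int[mu]_t (tail_step c N t * h t) = 0.
Proof.
pose p : {poly R} := (1 - 'X^N) ^+ Num.truncn (expR (N%:R * c)).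
have E t : tail_step c N t * h t = p.[expR (- t)] * (expR (- (0%:R * t)) * h t).
  rewrite mul0r oppr0 expR0 mul1r /tail_step /p horner_exp hornerD hornerN hornerXn hornerC.
  by rewrite -expRM_natl mulrN.
by under eq_fun do rewrite E; exact: poly_moment.
Qed.

(** Dominated convergence along [tail_step c N]. *)
Lemma tail_integral0 c : 0 < c -> \int[mu]_(t in `]c, +oo[) h t = 0.
Proof.
move=> c0; rewrite Rintegral_mkcond.
pose f (N : nat) t := (tail_step c N t * h t)%:E.
have mh := L1_measurable ih.
have mtail : measurable_fun setT (h \_ `]c, +oo[).
  by apply/(measurable_restrictT _ _).1 => //; exact: measurable_funTS.
have mf N : measurable_fun setT (f N).
  by apply/measurable_EFinP; exact: (L1_measurable (tail_step_moment c N).1).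
have ff : {ae mu, forall t, setT t -> f ^~ t @ \oo --> (h \_ `]c, +oo[ t)%:E}.
  exists [set c]; split; first exact: measurable_set1.
    exact: lebesgue_measure_set1.
  move=> t /= /not_implyP[_ nt]; apply: contrapT => /eqP tc; apply: nt.
  apply: cvg_EFin; first exact: nearW.
  have [t0|t0] := ltP t 0.
    rewrite patchE; case: ifP => _; rewrite ?h0//;
    by under eq_fun do rewrite /= /f h0// mulr0; exact: cvg_cst.
  rewrite (_ : (h \_ `]c, +oo[) t = (c < t)%R%:R * h t); last first.
    have tE : (t \in `]c, +oo[%classic) = (c < t).
      by apply/idP/idP; rewrite inE/= in_itv/= andbT.
    by rewrite patchE tE; case: ltP => _; rewrite ?mul1r ?mul0r.
  apply: cvgM; last exact: cvg_cst.
  apply/cvgrPdist_le => e e0.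
  have d0 : 0 < `|t - c| by rewrite normr_gt0 subr_eq0.
  near=> N; rewrite distrC; apply: le_trans (tail_step_close N t0 (ltW c0)) _.
  have p0 : 0 < 1 + N%:R * `|t - c| by rewrite ltr_pwDl// mulr_ge0.
  rewrite -[leRHS]invrK lef_pV2 ?posrE ?invr_gt0//.
  apply: (@le_trans _ _ (N%:R * `|t - c|)); last by rewrite lerDr.
  rewrite -ler_pdivrMr//; near: N; exact: nbhs_infty_ger.
have fg : {ae mu, forall t N, setT t -> (`|f N t| <= (`|h t|)%:E)%E}.
  apply: aeW => t N _; rewrite /f lee_fin.
  have [t0|t0] := ltP t 0; first by rewrite /= (h0 t0) mulr0.
  have /andP[s0 s1] := tail_step01 c N t0.
  by rewrite normrM ger0_norm// ler_piMl.
have mt : measurable_fun setT (fun t => ((h \_ `]c, +oo[) t)%:E) by exact/measurable_EFinP.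
have [_ _ ] := @dominated_convergence _ _ _ mu setT measurableT f _ _
  mf mt ff (integrable_norm ih) fg.
rewrite /Rintegral (_ : (fun n => _) = cst 0%E).
  by move=> /cvg_lim <-//; rewrite lim_cst.
apply/funext => N; have [L I0] := tail_step_moment c N.
rewrite /f -[LHS]fineK; last exact: integrable_fin_num.
by congr EFin.
Unshelve. all: by end_near. Qed.

(** The integrals over all half-lines vanish, so [h] vanishes almost everywhere
    by Lebesgue's differentiation theorem. *)
Lemma moments_ae0 : {ae mu, forall t, h t = 0}.
Proof.
have F0 c : \int[mu]_(t in `]-oo, c]) h t = 0.
  have lt0 : \int[mu]_(t in `]-oo, 0[) h t = 0.
    rewrite (@eq_Rintegral _ _ _ mu _ (cst 0)) ?Rintegral_cst ?mul0r//.
    by move=> t; rewrite inE/= in_itv/= => /h0.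
  have [c0|c0] := ltP 0 c.
    have UE : `]-oo, c]%classic `|` `]c, +oo[%classic = [set: R].
      by rewrite -itv_bndbnd_setU// set_itvNyy.
    have dis : [disjoint `]-oo, c]%classic & `]c, +oo[%classic].
      by apply/disj_set2P; rewrite -subset0 => t/=; rewrite !in_itv/= andbT => -[]; lra.
    have iU : mu.-integrable (`]-oo, c]%classic `|` `]c, +oo[%classic) (EFin \o h).
      by rewrite UE.
    have := @Rintegral_setU _ _ _ mu _ _ h (measurable_itv _) (measurable_itv _) iU dis.
    rewrite tail_integral0// addr0 => <-; rewrite UE.
    rewrite -(moments0 0%N); apply: eq_Rintegral => t _.
    by rewrite mul0r oppr0 expR0 mul1r.
  have [cn|cn] := ltP c 0.
    rewrite (@eq_Rintegral _ _ _ mu _ (cst 0)) ?Rintegral_cst ?mul0r//.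
    by move=> t; rewrite inE/= in_itv/= => tc; apply: h0; lra.
  have -> : c = 0 by lra.
  by rewrite -Rintegral_itv_bndo_bndc//; apply: integrableS ih.
have iy y : mu.-integrable `]-oo, y] (EFin \o h) by apply: integrableS ih.
have loc : locally_integrable [set: R] h.
  by apply: open_integrable_locally => //; exact: openT.
have := FTC1Ny iy loc.
have -> : (fun x => \int[mu]_(t in `]-oo, x]) h t) = cst 0.
  by apply/funext => x; exact: F0.
apply: filterS; first exact: (ae_filter_ringOfSetsType mu).
by move=> t [_ <-]; rewrite derive1_cst.
Qed.
End moments.
End Laplace.

(** * Complex signals and their Laplace transforms *)

Section ComplexSignals.
Context {R : realType}.
Notation mu := (@lebesgue_measure R).
Local Notation C := R[i].
Implicit Types (f g h : R -> C) (s a : C) (t r : R).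

Definition cL1 f := L1 mu (fun t => complex.Re (f t)) /\ L1 mu (fun t => complex.Im (f t)).
Definition csq f := sq mu (fun t => complex.Re (f t)) /\ sq mu (fun t => complex.Im (f t)).

Lemma csqM f g : csq f -> csq g -> cL1 (fun t => f t * g t).
Proof.
move=> [fr fi] [gr gi]; split.
  by under eq_fun do rewrite ReM; apply: L1B; exact: sqM.
by under eq_fun do rewrite ImM; apply: L1D; exact: sqM.
Qed.

Lemma csq_conj f : csq f -> csq (fun t => (f t)^*%C).
Proof.
move=> [fr fi]; split; first by under eq_fun do rewrite Re_conj.
under eq_fun do rewrite Im_conj -mulN1r; exact: sqZ.
Qed.

Lemma csqZD a f g : csq f -> csq g -> csq (fun t => a * f t + g t).
Proof.
move=> [fr fi] [gr gi]; split.
  under eq_fun do rewrite ReD ReM.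
  by apply: sqD => //; apply: sqB; exact: sqZ.
under eq_fun do rewrite ImD ImM.
by apply: sqD => //; apply: sqD; exact: sqZ.
Qed.

Lemma csq0 : csq (fun=> 0).
Proof. by split; exact: sq0. Qed.

Lemma cL1ZD a f g : cL1 f -> cL1 g -> cL1 (fun t => a * f t + g t).
Proof.
move=> [fr fi] [gr gi]; split.
  under eq_fun do rewrite ReD ReM.
  by apply: L1D => //; apply: L1B; exact: L1Z.
under eq_fun do rewrite ImD ImM.
by apply: L1D => //; apply: L1D; exact: L1Z.
Qed.

Lemma cL1_0 : cL1 (fun=> 0).
Proof. by split; exact: L1_0. Qed.

Lemma cL1_sum (I : Type) (r : seq I) (F : I -> R -> C) :
  (forall i, cL1 (F i)) -> cL1 (fun t => \sum_(i <- r) F i t).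
Proof.
move=> FL; elim: r => [|i r IH].
  by under eq_fun do rewrite big_nil; exact: cL1_0.
under eq_fun do rewrite big_cons -[F i _]mul1r; exact: cL1ZD.
Qed.

Lemma cintegralZD a f g : cL1 f -> cL1 g ->
  cintegral (fun t => a * f t + g t) = a * cintegral f + cintegral g.
Proof.
move=> [fr fi] [gr gi]; apply: complexP; rewrite ?ReD ?ImD ?ReM ?ImM /cintegral/=.
  under eq_Rintegral do rewrite ReD ReM.
  have h1 := L1Z (complex.Re a) fr; have h2 := L1Z (complex.Im a) fi.
  rewrite (RintegralD measurableT (L1B h1 h2) gr) (RintegralB measurableT h1 h2).
  by rewrite !RintegralZl.
under eq_Rintegral do rewrite ImD ImM.
have h1 := L1Z (complex.Re a) fi; have h2 := L1Z (complex.Im a) fr.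
rewrite (RintegralD measurableT (L1D h1 h2) gi) (RintegralD measurableT h1 h2).
by rewrite !RintegralZl.
Qed.

Lemma cintegral_conj f : cL1 f ->
  cintegral (fun t => (f t)^*%C) = (cintegral f)^*%C.
Proof.
move=> [fr fi]; apply: complexP; rewrite /cintegral/=.
  by under eq_Rintegral do rewrite Re_conj.
under eq_Rintegral do rewrite Im_conj -mulN1r.
by rewrite RintegralZl// mulN1r.
Qed.

Lemma ae_cintegral f g : cL1 f -> cL1 g -> {ae mu, forall t, f t = g t} ->
  cintegral f = cintegral g.
Proof.
move=> [fr fi] [gr gi] fg; rewrite /cintegral; congr Complex.
  apply: (ae_Rintegral (L1_measurable fr) (L1_measurable gr)).
  by apply: ae_imp fg => t ->.
apply: (ae_Rintegral (L1_measurable fi) (L1_measurable gi)).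
by apply: ae_imp fg => t ->.
Qed.

Lemma cintegral0 : cintegral (fun=> 0 : C) = 0.
Proof. by rewrite /cintegral !Rintegral_cst// mul0r. Qed.

Lemma cintegral_sum (I : Type) (r : seq I) (F : I -> R -> C) :
  (forall i, cL1 (F i)) ->
  cintegral (fun t => \sum_(i <- r) F i t) = \sum_(i <- r) cintegral (F i).
Proof.
move=> FL; elim: r => [|i r IH].
  rewrite big_nil; under eq_fun do rewrite big_nil; exact: cintegral0.
rewrite big_cons -IH -[cintegral (F i)]mul1r -(cintegralZD 1 (FL i) (cL1_sum r FL)).
by congr cintegral; apply/funext => t; rewrite big_cons mul1r.
Qed.

(** The transform at [s] is the integral of the signal against this function,
    the conjugate of the reproducing kernel. *)
Definition causal_exp s t : C := if t < 0 then 0 else cexp (- s * t%:C%C).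

Lemma sq_causal_expR r : 0 < r ->
  sq mu (fun t => if t < 0 then 0 else expR (- (r * t))).
Proof.
move=> r0; have r20 : 0 < 2 * r by rewrite mulr_gt0.
have E : (fun t => (if t < 0 then 0 else expR (- (r * t))) ^+ 2) =
         (fun t => (2 * r)^-1 * exponential_pdf (2 * r) t).
  apply/funext => t; have [t0|t0] := ltP t 0.
    by rewrite lt0_exponential_pdf// mulr0 expr0n.
  rewrite exponential_pdfE// mulKf ?gt_eqF// -expRM_natl.
  by congr expR; rewrite -mulr_natl; ring.
split; last by rewrite E; apply: L1Z; exact: integrable_exponential_pdf.
apply: measurable_fun_if => //.
- exact: measurable_fun_ltr.
- apply: measurable_funTS; exact: measurable_expRM.
Qed.

Lemma cexp_bound s t :
  `|complex.Re (cexp (- s * t%:C%C))| <= expR (- (complex.Re s * t)) /\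
  `|complex.Im (cexp (- s * t%:C%C))| <= expR (- (complex.Re s * t)).
Proof.
have -> : expR (- (complex.Re s * t)) = expR (complex.Re (- s * t%:C%C)).
  by case: s => x y /=; rewrite mulr0 subr0 mulNr.
move: (- s * _) => z; rewrite /cexp ReM ImM/= !mul0r subr0 addr0 !normrM.
rewrite (ger0_norm (expR_ge0 _)).
split; rewrite -[leRHS]mulr1; apply: ler_wpM2l; rewrite ?expR_ge0//.
  by rewrite ler_norml cos_geN1 cos_le1.
by rewrite ler_norml sin_geN1 sin_le1.
Qed.

Lemma cexpE s t : cexp (- s * t%:C%C) =
  Complex (expR (- (complex.Re s * t)) * cos (complex.Im s * t))
  (- (expR (- (complex.Re s * t)) * sin (complex.Im s * t))).
Proof.
case: s => x y; rewrite /cexp.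
have -> : - Complex x y * t%:C%C = Complex (- (x * t)) (- (y * t)).
  by apply: complexP; rewrite /=; ring.
by apply: complexP; rewrite /= cosN sinN; ring.
Qed.

Lemma csq_causal_exp s : 0 < complex.Re s -> csq (causal_exp s).
Proof.
move=> s0; have sqe := sq_causal_expR s0.
have me := measurable_expRM (complex.Re s).
have my : measurable_fun setT (fun t : R => complex.Im s * t) by exact: measurable_funM.
have m0 : measurable_fun setT (fun t : R => t < 0) by exact: measurable_fun_ltr.
split; apply: sq_le sqe.
- rewrite (_ : (fun t => _) = fun t => if t < 0 then 0 else
    expR (- (complex.Re s * t)) * cos (complex.Im s * t)); last first.
    by apply/funext => t; rewrite /causal_exp cexpE; case: ifP.
  apply: measurable_fun_if => //; apply: measurable_funTS; apply: measurable_funM => //.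
  apply: (measurableT_comp _ my); apply: continuous_measurable_fun.
  exact: continuous_cos.
- move=> t; rewrite /causal_exp; case: ifP => // _.
  by rewrite [leRHS]ger0_norm ?expR_ge0//; exact: (cexp_bound s t).1.
- rewrite (_ : (fun t => _) = fun t => if t < 0 then 0 else
    - (expR (- (complex.Re s * t)) * sin (complex.Im s * t))); last first.
    by apply/funext => t; rewrite /causal_exp cexpE; case: ifP.
  apply: measurable_fun_if => //; apply: measurable_funTS; apply: measurable_funN.
  apply: measurable_funM => //.
  apply: (measurableT_comp _ my); apply: continuous_measurable_fun.
  exact: continuous_sin.
- move=> t; rewrite /causal_exp; case: ifP => // _.
  by rewrite [leRHS]ger0_norm ?expR_ge0//; exact: (cexp_bound s t).2.
Qed.

(** A Laplace transform is determined by its values at the positive integers.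
    At these points the kernel is real, so the real and imaginary parts of
    [e^(-t) f(t)] have vanishing exponential moments. *)
Lemma lerch f : csq f -> (forall t, t < 0 -> f t = 0) ->
  (forall n : nat, cintegral (fun t => causal_exp n.+1%:R t * f t) = 0) ->
  {ae mu, forall t, f t = 0}.
Proof.
move=> sf f0 If.
have E n t : causal_exp n.+1%:R t * f t =
    ((expR (- (n%:R * t)) * expR (- t))%:C)%C * f t.
  rewrite /causal_exp; case: ltP => t0; first by rewrite f0// !mulr0.
  rewrite cexpE -[n.+1%:R : C](rmorph_nat (real_complex R)) /= mul0r cos0 sin0 mulr0 oppr0 mulr1.
  by rewrite -expRD -natr1; congr (_%:C%C * _); congr expR; ring.
(* [p] is the real or the imaginary part. *)
have real_part (p : C -> R) : (forall (x : R) z, p (x%:C%C * z) = x * p z) -> p 0 = 0 ->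
    L1 mu (fun t => p (causal_exp 1 t * f t)) ->
    (forall n, \int[mu]_t p (causal_exp n.+1%:R t * f t) = 0) ->
    {ae mu, forall t, p (f t) = 0}.
  move=> pM p0 Lp Ip.
  suff : {ae mu, forall t, expR (- t) * p (f t) = 0}.
    by apply: ae_imp => t /eqP; rewrite mulf_eq0 gt_eqF ?expR_gt0//= => /eqP.
  apply: moments_ae0.
  - move: Lp; under eq_fun do rewrite (E 0%N) pM mul0r oppr0 expR0 mul1r; exact.
  - by move=> t t0; rewrite f0// p0 mulr0.
  - move=> n; rewrite -(Ip n); apply: eq_Rintegral => t _.
    by rewrite E pM mulrA.
have c1 : 0 < complex.Re (1 : C) by rewrite /= ltr01.
have [Lr Li] := csqM (csq_causal_exp c1) sf.
have hr : {ae mu, forall t, complex.Re (f t) = 0}.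
  apply: real_part => //; first by move=> x z; rewrite ReM_real.
  by move=> n; have := If n => -[].
have hi : {ae mu, forall t, complex.Im (f t) = 0}.
  apply: real_part => //; first by move=> x z; rewrite ImM /= mul0r addr0.
  by move=> n; have := If n => -[].
by apply: ae_imp2 hr hi => t ? ?; apply: complexP.
Qed.
End ComplexSignals.

(** * The Hardy space as a Hilbert space with reproducing kernel *)

Section ExpShift.
Context {R : realType}.
Notation mu := (@lebesgue_measure R).

Lemma exp_shift_cvg (g : R -> R) : L1 mu g -> (forall t, t < 0 -> g t = 0) ->
  (fun n => \int[mu]_t (expR (- (n.+1%:R^-1 * t)) * g t)) @ \oo --> \int[mu]_t g t.
Proof.
move=> Lg g0; have mg := L1_measurable Lg.
pose f (n : nat) t := (expR (- (n.+1%:R^-1 * t)) * g t)%:E.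
have mf n : measurable_fun setT (f n).
  have me := measurable_expRM (n.+1%:R^-1 : R).
  by apply/measurable_EFinP; exact: measurable_funM.
have fg : {ae mu, forall t n, setT t -> (`|f n t| <= (`|g t|)%:E)%E}.
  apply: aeW => t n _; rewrite /f lee_fin.
  have [t0|t0] := ltP t 0; first by rewrite g0// mulr0.
  rewrite normrM ger0_norm ?expR_ge0// ler_piMl// -[leRHS]expR0 ler_expR oppr_le0.
  by rewrite mulr_ge0// invr_ge0.
have ff : {ae mu, forall t, setT t -> f ^~ t @ \oo --> (g t)%:E}.
  apply: aeW => t _; apply: cvg_EFin; first exact: nearW.
  have H : (fun n : nat => - (n.+1%:R^-1 * t)) @ \oo --> (0 : R).
    rewrite (_ : 0 = - (0 * t)); last by rewrite mul0r oppr0.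
    by apply: cvgN; apply: cvgMr_tmp; exact: cvg_harmonic.
  have H2 : (fun n : nat => expR (- (n.+1%:R^-1 * t))) @ \oo --> (1 : R).
    suff : (fun n : nat => expR (- (n.+1%:R^-1 * t))) @ \oo --> expR (0 : R).
      by rewrite expR0.
    apply: continuous_cvg; last exact: H.
    exact: continuous_expR.
  rewrite -[g t in X in _ --> X]mul1r; apply: cvgMr_tmp; exact: H2.
have mgE : measurable_fun setT (fun t => (g t)%:E) by exact/measurable_EFinP.
have [_ _ h] := @dominated_convergence _ _ _ mu setT measurableT f _ _
  mf mgE ff (integrable_norm Lg) fg.
have : [sequence (\int[mu]_t f n t)%E]_n @ \oo --> (\int[mu]_t g t)%:E.
  by move: h; rewrite /Rintegral fineK//; exact: integrable_fin_num.
by move/fine_cvg.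
Qed.
End ExpShift.

Section Hardy.
Context {R : realType}.
Notation mu := (@lebesgue_measure R).
Local Notation C := R[i].

Section dim.
Variable k : nat.
Implicit Types (f g h : R -> 'cV[C]_k) (F G : C -> 'cV[C]_k) (s a : C) (t : R).

Lemma causalP f : causal_L2 f <->
  (forall j, csq (fun t => f t j 0)) /\ (forall t, t < 0 -> f t = 0).
Proof.
split=> [[mr mi f0 en]|[sf f0]].
  split=> // j.
  have L : L1 mu (fun t => \sum_j (complex.Re (f t j 0) ^+ 2 + complex.Im (f t j 0) ^+ 2)).
    apply/integrableP; split.
      apply/measurable_EFinP; apply: measurable_sum => i.
      by apply: measurable_funD; apply: measurable_funX; [exact: mr|exact: mi].
    apply: le_lt_trans en; rewrite le_eqVlt; apply/orP; left; apply/eqP.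
    apply: eq_integral => t _ /=; rewrite ger0_norm// sumr_ge0// => i _.
    by rewrite addr_ge0 ?sqr_ge0.
  have le t : complex.Re (f t j 0) ^+ 2 + complex.Im (f t j 0) ^+ 2 <=
      \sum_j (complex.Re (f t j 0) ^+ 2 + complex.Im (f t j 0) ^+ 2).
    rewrite (bigD1 j)//= lerDl sumr_ge0// => i _.
    by rewrite addr_ge0 ?sqr_ge0.
  split; (split; [by move: (mr j) (mi j)|apply: (L1_le _ _ L)]).
  - by apply: measurable_funX; exact: mr.
  - by move=> t; rewrite ger0_norm ?sqr_ge0//; apply: le_trans (le t); rewrite lerDl sqr_ge0.
  - by apply: measurable_funX; exact: mi.
  - by move=> t; rewrite ger0_norm ?sqr_ge0//; apply: le_trans (le t); rewrite lerDr sqr_ge0.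
split=> //.
- by move=> j; exact: (sf j).1.1.
- by move=> j; exact: (sf j).2.1.
rewrite /energy; apply: integrable_lty => //.
apply: L1_sum => j; have [[_ Lr] [_ Li]] := sf j; exact: L1D.
Qed.

Lemma causal_csq f j : causal_L2 f -> csq (fun t => f t j 0).
Proof. by move=> /causalP[]. Qed.

Lemma causal_lt0 f t : causal_L2 f -> t < 0 -> f t = 0.
Proof. by move=> /causalP[_]; apply. Qed.

Lemma causalZD a f g : causal_L2 f -> causal_L2 g ->
  causal_L2 (fun t => a *: f t + g t).
Proof.
move=> /causalP[sf f0] /causalP[sg g0]; apply/causalP; split.
  by move=> j; under eq_fun do rewrite !mxE; exact: csqZD.
by move=> t t0; rewrite f0// g0// scaler0 addr0.
Qed.

Lemma causal0 : causal_L2 (fun=> 0 : 'cV[C]_k).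
Proof.
by apply/causalP; split=> // j; under eq_fun do rewrite mxE; exact: csq0.
Qed.

Lemma fourierE f s j : causal_L2 f -> 0 < complex.Re s ->
  fourier f s j 0 = cintegral (fun t => causal_exp s t * f t j 0).
Proof.
move=> cf s0; rewrite /fourier s0 mxE; congr cintegral; apply/funext => t.
rewrite /causal_exp; case: ltP => // t0.
by rewrite (causal_lt0 cf t0) mxE !mulr0.
Qed.

Lemma cL1_exp f s j : causal_L2 f -> 0 < complex.Re s ->
  cL1 (fun t => causal_exp s t * f t j 0).
Proof. by move=> cf s0; apply: csqM; [exact: csq_causal_exp|exact: causal_csq]. Qed.

Lemma fourierZD a f g : causal_L2 f -> causal_L2 g ->
  fourier (fun t => a *: f t + g t) = a *: fourier f + fourier g :> (C -> 'cV[C]_k).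
Proof.
move=> cf cg; apply/funext => s.
have -> : (a *: fourier f + fourier g) s = a *: fourier f s + fourier g s by [].
have [s0|s0] := ltP 0 (complex.Re s); last first.
  by rewrite /fourier ltNge s0 /= scaler0 addr0.
apply/colP => j; rewrite !mxE !fourierE//; last exact: causalZD.
rewrite -cintegralZD; [|exact: cL1_exp|exact: cL1_exp].
by congr cintegral; apply/funext => t; rewrite !mxE; ring.
Qed.

Lemma fourier0 : fourier (fun=> 0 : 'cV[C]_k) = 0 :> (C -> 'cV[C]_k).
Proof.
by have := fourierZD (-1) causal0 causal0; rewrite scaler0 addr0 scaleN1r addNr.
Qed.

Lemma ae_fourier f g : causal_L2 f -> causal_L2 g -> {ae mu, forall t, f t = g t} ->
  fourier f = fourier g :> (C -> 'cV[C]_k).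
Proof.
move=> cf cg fg; apply/funext => s.
have [s0|s0] := ltP 0 (complex.Re s); last by rewrite /fourier ltNge s0.
apply/colP => j; rewrite !fourierE//; apply: ae_cintegral; do ?exact: cL1_exp.
by apply: ae_imp fg => t ->.
Qed.

Lemma fourier_inj f g : causal_L2 f -> causal_L2 g ->
  (forall n, fourier f n.+1%:R = fourier g n.+1%:R :> 'cV[C]_k) ->
  {ae mu, forall t, f t = g t}.
Proof.
move=> cf cg fg; pose h t := -1 *: g t + f t.
have ch : causal_L2 h by exact: causalZD.
suff : {ae mu, forall t j, h t j 0 = 0}.
  apply: ae_imp => t ht; apply/eqP; rewrite -subr_eq0; apply/eqP/colP => j.
  by have := ht j; rewrite !mxE mulN1r addrC.
apply: ae_finite => j; apply: lerch; first exact: causal_csq.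
  by move=> t t0; rewrite (causal_lt0 ch t0) mxE.
move=> n; have n0 : 0 < complex.Re (n.+1%:R : C).
  by rewrite -(rmorph_nat (real_complex R)) /= ltr0n.
rewrite -fourierE// (fourierZD _ cg cf).
by rewrite -[LHS]/((-1 *: fourier g n.+1%:R + fourier f n.+1%:R) j 0) fg scaleN1r addNr mxE.
Qed.

Lemma cL1_dot f g : causal_L2 f -> causal_L2 g ->
  cL1 (fun t => \sum_j (f t j 0)^*%C * g t j 0).
Proof.
move=> cf cg; apply: cL1_sum => j.
by apply: csqM; [apply: csq_conj|]; exact: causal_csq.
Qed.

Lemma L2dotE f g :
  L2dot f g = cintegral (fun t => \sum_j (f t j 0)^*%C * g t j 0).
Proof. by []. Qed.

Lemma L2dotZD a f g h : causal_L2 f -> causal_L2 g -> causal_L2 h ->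
  L2dot f (fun t => a *: g t + h t) = a * L2dot f g + L2dot f h.
Proof.
move=> cf cg ch; rewrite /L2dot -cintegralZD; [|exact: cL1_dot|exact: cL1_dot].
congr cintegral; apply/funext => t; rewrite mulr_sumr -big_split/=.
by apply: eq_bigr => j _; rewrite !mxE; ring.
Qed.

Lemma L2dotC f g : causal_L2 f -> causal_L2 g -> L2dot g f = (L2dot f g)^*%C.
Proof.
move=> cf cg; rewrite /L2dot -cintegral_conj; last exact: cL1_dot.
congr cintegral; apply/funext => t; rewrite rmorph_sum/=.
by apply: eq_bigr => j _; rewrite rmorphM/= conjcK mulrC.
Qed.

Lemma ae_L2dot f f' g g' :
  causal_L2 f -> causal_L2 f' -> causal_L2 g -> causal_L2 g' ->
  {ae mu, forall t, f t = f' t} -> {ae mu, forall t, g t = g' t} ->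
  L2dot f g = L2dot f' g'.
Proof.
move=> cf cf' cg cg' ff gg; apply: ae_cintegral; do ?exact: cL1_dot.
by apply: ae_imp2 ff gg => t -> ->.
Qed.

Lemma Re_L2dot f : causal_L2 f -> complex.Re (L2dot f f) =
  \sum_j (\int[mu]_t complex.Re (f t j 0) ^+ 2 + \int[mu]_t complex.Im (f t j 0) ^+ 2).
Proof.
move=> cf; rewrite /L2dot cintegral_sum; last first.
  by move=> j; apply: csqM; [apply: csq_conj|]; exact: causal_csq.
have Re_sum (r : seq 'I_k) (F : 'I_k -> C) :
    complex.Re (\sum_(j <- r) F j) = \sum_(j <- r) complex.Re (F j).
  by elim: r => [|j r IH]; rewrite ?big_nil// !big_cons ReD IH.
rewrite Re_sum; apply: eq_bigr => j _; rewrite /cintegral /=.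
have [[_ Lr] [_ Li]] := causal_csq j cf.
rewrite -RintegralD//; apply: eq_Rintegral => t _.
by rewrite ReM Re_conj Im_conj; ring.
Qed.

Lemma signalP F : H2 R k F -> causal_L2 (signal F) /\ fourier (signal F) = F.
Proof. by move=> [f cf fF]; rewrite /signal; case: xgetP => [g _ //|/(_ f)[]]. Qed.

Lemma H2_fourier f : causal_L2 f -> H2 R k (fourier f).
Proof. by move=> cf; exists f. Qed.

(** [signal] chooses some causal signal with the given transform; by injectivity
    of the transform it agrees almost everywhere with any other. *)
Lemma ae_signal f : causal_L2 f -> {ae mu, forall t, signal (fourier f) t = f t}.
Proof.
move=> cf; have [cs sE] := signalP (H2_fourier cf).
by apply: fourier_inj => // n; rewrite sE.
Qed.

Lemma H2dotE f g : causal_L2 f -> causal_L2 g ->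
  H2dot (fourier f) (fourier g) = L2dot f g.
Proof.
move=> cf cg; have [cs _] := signalP (H2_fourier cf).
have [cs' _] := signalP (H2_fourier cg).
by apply: ae_L2dot => //; exact: ae_signal.
Qed.

Lemma eventually_sum (I : Type) (r : seq I) (x : I -> nat -> R) :
  (forall i (e : R), 0 < e -> exists N, forall n, (N <= n)%N -> x i n < e) ->
  forall e : R, 0 < e -> exists N, forall n, (N <= n)%N -> \sum_(i <- r) x i n < e.
Proof.
move=> h; elim: r => [|i r IH] e e0.
  by exists 0%N => n _; rewrite big_nil.
have e20 : 0 < e / 2 by rewrite divr_gt0.
have [N1 h1] := h i _ e20; have [N2 h2] := IH _ e20.
exists (maxn N1 N2) => n; rewrite geq_max => /andP[n1 n2].
by rewrite big_cons [ltRHS]splitr ltrD ?h1 ?h2.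
Qed.

(** Completeness of [L2], applied to the real and imaginary parts of each
    coordinate. *)
Lemma L2_vector_complete (u : nat -> R -> 'cV[C]_k) : (forall n, causal_L2 (u n)) ->
  (forall e : R, 0 < e -> exists N, forall i j, (N <= i)%N -> (N <= j)%N ->
     complex.Re (L2dot (fun t => -1 *: u j t + u i t) (fun t => -1 *: u j t + u i t)) < e) ->
  exists2 f, causal_L2 f & forall e : R, 0 < e -> exists N, forall i, (N <= i)%N ->
     complex.Re (L2dot (fun t => -1 *: f t + u i t) (fun t => -1 *: f t + u i t)) < e.
Proof.
move=> cu cauchy.
have comp (p : C -> R) (pB : forall z w, p (-1 * w + z) = p z - p w) (p0 : p 0 = 0)
    (pL : forall z, p z ^+ 2 <= complex.Re z ^+ 2 + complex.Im z ^+ 2)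
    (ps : forall n j, sq mu (fun t => p (u n t j 0))) j : exists f : R -> R, [/\ sq mu f,
    forall t, t < 0 -> f t = 0 & forall e : R, 0 < e -> exists N, forall i, (N <= i)%N ->
      \int[mu]_t (p (u i t j 0) - f t) ^+ 2 < e].
  have [|f [sf f0 fu]] := L2_complete (fun n => ps n j).
    move=> e /cauchy[N hN]; exists N => a b Na Nb; apply: le_lt_trans (hN a b Na Nb).
    have cd : causal_L2 (fun t => -1 *: u b t + u a t) by exact: causalZD.
    rewrite Re_L2dot//; apply: (@le_trans _ _
      (\int[mu]_t complex.Re ((-1 *: u b t + u a t) j 0) ^+ 2 +
       \int[mu]_t complex.Im ((-1 *: u b t + u a t) j 0) ^+ 2)).
      have [[_ Lr] [_ Li]] := causal_csq j cd.
      rewrite -RintegralD//; apply: le_Rintegral => //.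
      - by have [] := sqB (ps a j) (ps b j).
      - exact: L1D.
      - by move=> t _; rewrite -pB; have := pL ((-1 *: u b t + u a t) j 0); rewrite !mxE.
    rewrite [leRHS](bigD1 j)//= lerDl sumr_ge0// => i _.
    by rewrite addr_ge0//; apply: Rintegral_ge0 => t _; exact: sqr_ge0.
  exists f; split=> // t t0; apply: f0 => n.
  by rewrite (causal_lt0 (cu n) t0) mxE.
have ReB z w : complex.Re (-1 * w + z : C) = complex.Re z - complex.Re w.
  by case: z w => a b [c d] /=; ring.
have ImB z w : complex.Im (-1 * w + z : C) = complex.Im z - complex.Im w.
  by case: z w => a b [c d] /=; ring.
have Rele (z : C) : complex.Re z ^+ 2 <= complex.Re z ^+ 2 + complex.Im z ^+ 2.
  by rewrite lerDl sqr_ge0.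
have Imle (z : C) : complex.Im z ^+ 2 <= complex.Re z ^+ 2 + complex.Im z ^+ 2.
  by rewrite lerDr sqr_ge0.
have /choice[fr frP] := comp (@complex.Re R) ReB (erefl _) Rele
  (fun n j => (causal_csq j (cu n)).1).
have /choice[fi fiP] := comp (@complex.Im R) ImB (erefl _) Imle
  (fun n j => (causal_csq j (cu n)).2).
pose f t : 'cV[C]_k := \col_j Complex (fr j t) (fi j t).
have cf : causal_L2 f.
  apply/causalP; split.
    move=> j; split; under eq_fun do rewrite mxE /=.
      by have [] := frP j.
    by have [] := fiP j.
  move=> t t0; apply/colP => j; rewrite !mxE; apply: complexP => /=.
    by have [_ h _] := frP j; exact: h.
  by have [_ h _] := fiP j; exact: h.
exists f => // e e0.
pose x j n := \int[mu]_t (complex.Re (u n t j 0) - fr j t) ^+ 2 +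
              \int[mu]_t (complex.Im (u n t j 0) - fi j t) ^+ 2.
have [|N hN] := @eventually_sum _ (index_enum 'I_k) x _ e e0.
  move=> j {e0}e e0; have e20 : 0 < e / 2 by rewrite divr_gt0.
  have [_ _ /(_ _ e20)[N1 h1]] := frP j; have [_ _ /(_ _ e20)[N2 h2]] := fiP j.
  exists (maxn N1 N2) => n; rewrite geq_max => /andP[n1 n2].
  by rewrite /x [ltRHS]splitr ltrD ?h1 ?h2.
exists N => i Ni; apply: le_lt_trans (hN i Ni).
rewrite Re_L2dot; last exact: causalZD.
rewrite le_eqVlt; apply/orP; left; apply/eqP; apply: eq_bigr => j _.
by congr (_ + _); apply: eq_Rintegral => t _; rewrite !mxE ?ReB ?ImB.
Qed.

Lemma H2_hilbert : hilbert (H2 R k) (@H2dot R k).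
Proof.
have ex F : H2 R k F -> exists2 f, causal_L2 f & F = fourier f.
  by move=> [f cf <-]; exists f.
split.
- by exists (fun=> 0); [exact: causal0|exact: fourier0].
- move=> a F G /ex[f cf ->] /ex[g cg ->]; rewrite -fourierZD//.
  by apply: H2_fourier; exact: causalZD.
- move=> a F G K /ex[f cf ->] /ex[g cg ->] /ex[h ch ->].
  have cgh := causalZD a cg ch.
  by rewrite -fourierZD// !H2dotE// L2dotZD.
- by move=> F G /ex[f cf ->] /ex[g cg ->]; rewrite !H2dotE// -L2dotC.
- move=> F /ex[f cf ->]; rewrite /nrm2 H2dotE// Re_L2dot// sumr_ge0// => j _.
  by rewrite addr_ge0//; apply: Rintegral_ge0 => t _; exact: sqr_ge0.
- move=> F /ex[f cf ->]; rewrite /nrm2 H2dotE// Re_L2dot// => /eqP.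
  rewrite psumr_eq0; last first.
    by move=> j _; rewrite addr_ge0//; apply: Rintegral_ge0 => t _; exact: sqr_ge0.
  move=> /allP f0.
  suff h : {ae mu, forall t j, f t j 0 = 0}.
    rewrite -fourier0; apply: ae_fourier => //; first exact: causal0.
    by apply: ae_imp h => t ht; apply/colP => j; rewrite ht mxE.
  apply: ae_finite => j; have [[_ Lr] [_ Li]] := causal_csq j cf.
  have /f0/= := mem_index_enum j.
  rewrite paddr_eq0; last 2 first.
  - by apply: Rintegral_ge0 => t _; exact: sqr_ge0.
  - by apply: Rintegral_ge0 => t _; exact: sqr_ge0.
  move=> /andP[/eqP r0 /eqP i0].
  have hr := Rintegral_eq0 Lr (fun t => sqr_ge0 _) r0.
  have hi := Rintegral_eq0 Li (fun t => sqr_ge0 _) i0.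
  apply: ae_imp2 hr hi => t /eqP; rewrite sqrf_eq0 => /eqP tr /eqP.
  by rewrite sqrf_eq0 => /eqP ti; apply: complexP.
move=> U HU cauchy; have /choice[u uP] n : exists f, causal_L2 f /\ U n = fourier f.
  by have [f cf ->] := ex _ (HU n); exists f.
have cu n := (uP n).1.
have UB F i f : causal_L2 f -> F = fourier f -> nrm2 (@H2dot R k) (U i - F) =
    complex.Re (L2dot (fun t => -1 *: f t + u i t) (fun t => -1 *: f t + u i t)).
  move=> cf ->; have cd := causalZD (-1) cf (cu i).
  by rewrite (uP i).2 addrC -scaleN1r -fourierZD// /nrm2 H2dotE.
have [|f cf fu] := L2_vector_complete cu.
  move=> e /cauchy[N hN]; exists N => i j Ni Nj.
  by rewrite -(UB (U j) i (u j) (cu j) (uP j).2); exact: hN.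
exists (fourier f); first exact: H2_fourier.
move=> e /fu[N hN]; exists N => i Ni.
rewrite (UB _ _ f cf (erefl _)); exact: hN.
Qed.

(** The vector whose scalar product with a transform is the coordinate [j] of its
    value at [s]. *)
Definition kernel s (j : 'I_k) : C -> 'cV[C]_k :=
  fourier (fun t => (causal_exp s t)^*%C *: delta_mx j 0).

Lemma kernel_causal s j : 0 < complex.Re s ->
  causal_L2 (fun t => (causal_exp s t)^*%C *: delta_mx j 0 : 'cV[C]_k).
Proof.
move=> s0; apply/causalP; split; last first.
  by move=> t t0; rewrite /causal_exp t0 conjc0 scale0r.
move=> i; under eq_fun do rewrite !mxE mulrC -[_ * _]addr0.
by apply: csqZD; [apply: csq_conj; exact: csq_causal_exp|exact: csq0].
Qed.

Lemma H2_kernel s j : 0 < complex.Re s -> H2 R k (kernel s j).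
Proof. by move=> s0; apply: H2_fourier; exact: kernel_causal. Qed.

Lemma kernelP s j F : 0 < complex.Re s -> H2 R k F ->
  H2dot (kernel s j) F = F s j 0.
Proof.
move=> s0 [f cf <-]; rewrite H2dotE//; last exact: kernel_causal.
rewrite fourierE// L2dotE; congr cintegral; apply/funext => t.
rewrite (bigD1 j)//= big1 ?addr0 => [|i ij].
  by rewrite !mxE !eqxx mulr1 conjcK.
by rewrite !mxE (negbTE ij) mulr0 conjc0 mul0r.
Qed.

Lemma H2_inj F G : H2 R k F -> H2 R k G ->
  (forall n, F n.+1%:R = G n.+1%:R) -> F = G.
Proof.
move=> [f cf <-] [g cg <-] fg; apply: ae_fourier => //; exact: fourier_inj.
Qed.

(** Continuity along the sequence [s + 1 / (k + 1)] is what removes a finite set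
    of exceptional points from an identity between transforms. *)
Lemma H2_shift_cvg s j F : H2 R k F -> 0 < complex.Re s ->
  ((fun n : nat => complex.Re (F (s + (n.+1%:R^-1)%:C%C) j 0)) @ \oo --> complex.Re (F s j 0)) /\
  ((fun n : nat => complex.Im (F (s + (n.+1%:R^-1)%:C%C) j 0)) @ \oo --> complex.Im (F s j 0)).
Proof.
move=> [f cf <-] s0.
have sn (n : nat) : 0 < complex.Re (s + (n.+1%:R^-1 : R)%:C%C).
  by rewrite ReD /= addr_gt0// invr_gt0.
have [Lr Li] := cL1_exp j cf s0.
have E (n : nat) t : causal_exp (s + (n.+1%:R^-1)%:C%C) t * f t j 0 =
    (expR (- (n.+1%:R^-1 * t)))%:C%C * (causal_exp s t * f t j 0).
  rewrite mulrA; congr (_ * _); rewrite /causal_exp; case: ifP => _; first by rewrite mulr0.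
  rewrite !cexpE ReD ImD /= addr0 mulrDl opprD expRD.
  by apply: complexP => /=; ring.
have z t : t < 0 -> causal_exp s t * f t j 0 = 0 by move=> t0; rewrite /causal_exp t0 mul0r.
split; under eq_fun do rewrite fourierE// /cintegral /=; rewrite fourierE// /cintegral /=.
  have := exp_shift_cvg Lr; rewrite (_ : (fun n => _) = (fun n : nat =>
    \int[mu]_t complex.Re (causal_exp (s + (n.+1%:R^-1)%:C%C) t * f t j 0))).
    by apply=> t /z ->.
  by apply/funext => n; apply: eq_Rintegral => t _; rewrite E ReM_real.
have := exp_shift_cvg Li; rewrite (_ : (fun n => _) = (fun n : nat =>
  \int[mu]_t complex.Im (causal_exp (s + (n.+1%:R^-1)%:C%C) t * f t j 0))).
  by apply=> t /z ->.
by apply/funext => n; apply: eq_Rintegral => t _; rewrite E ImM /= mul0r addr0.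
Qed.
End dim.
End Hardy.

(** * Families of vectors: span, continuity, density *)

Section ComplexLimits.
Context {R : realType} {T : Type} (F : set_system T) {FF : Filter F}.
Local Notation C := R[i].
Implicit Types (f g : T -> C) (l k : C).

(** Limits are taken on real and imaginary parts, so that those of real-valued
    functions apply. *)
Definition ccvg f l := ((fun t => complex.Re (f t)) @ F --> complex.Re l) /\
  ((fun t => complex.Im (f t)) @ F --> complex.Im l).

Lemma ccvg_cst l : ccvg (fun=> l) l.
Proof. by split; exact: cvg_cst. Qed.

Lemma ccvgD f g l k : ccvg f l -> ccvg g k -> ccvg (fun t => f t + g t) (l + k).
Proof.
move=> [fr fi] [gr gi]; split.
  by under eq_fun do rewrite ReD; rewrite ReD; exact: cvgD.
by under eq_fun do rewrite ImD; rewrite ImD; exact: cvgD.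
Qed.

Lemma ccvgM f g l k : ccvg f l -> ccvg g k -> ccvg (fun t => f t * g t) (l * k).
Proof.
move=> [fr fi] [gr gi]; split.
  under eq_fun do rewrite ReM; rewrite ReM; apply: cvgB; exact: cvgM.
under eq_fun do rewrite ImM; rewrite ImM; apply: cvgD; exact: cvgM.
Qed.

Lemma ccvgN f l : ccvg f l -> ccvg (fun t => - f t) (- l).
Proof.
by move=> /(ccvgM (ccvg_cst (-1))); under eq_fun do rewrite mulN1r; rewrite mulN1r.
Qed.

Lemma ccvg_conj f l : ccvg f l -> ccvg (fun t => (f t)^*%C) (l^*%C).
Proof.
move=> [fr fi]; split; first by under eq_fun do rewrite Re_conj; rewrite Re_conj.
by under eq_fun do rewrite Im_conj; rewrite Im_conj; exact: cvgN.
Qed.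

Lemma ccvg_sum (I : Type) (r : seq I) (P : pred I) (f : I -> T -> C) (l : I -> C) :
  (forall i, ccvg (f i) (l i)) ->
  ccvg (fun t => \sum_(i <- r | P i) f i t) (\sum_(i <- r | P i) l i).
Proof.
move=> fl; elim: r => [|i r IH].
  by rewrite big_nil; under eq_fun do rewrite big_nil; exact: ccvg_cst.
rewrite big_cons; under eq_fun do rewrite big_cons.
by case: (P i) => //; apply: ccvgD.
Qed.

Lemma ccvg_prod (I : Type) (r : seq I) (P : pred I) (f : I -> T -> C) (l : I -> C) :
  (forall i, ccvg (f i) (l i)) ->
  ccvg (fun t => \prod_(i <- r | P i) f i t) (\prod_(i <- r | P i) l i).
Proof.
move=> fl; elim: r => [|i r IH].
  by rewrite big_nil; under eq_fun do rewrite big_nil; exact: ccvg_cst.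
rewrite big_cons; under eq_fun do rewrite big_cons.
by case: (P i) => //; apply: ccvgM.
Qed.

Lemma ccvg_det n (A : T -> 'M[C]_n) (L : 'M[C]_n) :
  (forall i j, ccvg (fun t => A t i j) (L i j)) -> ccvg (fun t => \det (A t)) (\det L).
Proof.
move=> AL; apply: ccvg_sum => s; apply: ccvgM; first exact: ccvg_cst.
by apply: ccvg_prod.
Qed.

Lemma ccvg_adj n (A : T -> 'M[C]_n) (L : 'M[C]_n) i j :
  (forall i j, ccvg (fun t => A t i j) (L i j)) ->
  ccvg (fun t => (\adj (A t)) i j) ((\adj L) i j).
Proof.
move=> AL; rewrite mxE; under eq_fun do rewrite mxE.
apply: ccvgM; first exact: ccvg_cst.
by apply: ccvg_det => a b; rewrite !mxE; under eq_fun do rewrite !mxE.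
Qed.

Lemma ccvg_mulmx n m p (A : T -> 'M[C]_(n, m)) (B : T -> 'M[C]_(m, p))
    (L : 'M[C]_(n, m)) (K : 'M[C]_(m, p)) i j :
  (forall i j, ccvg (fun t => A t i j) (L i j)) ->
  (forall i j, ccvg (fun t => B t i j) (K i j)) ->
  ccvg (fun t => (A t *m B t) i j) ((L *m K) i j).
Proof.
move=> AL BK; rewrite mxE; under eq_fun do rewrite mxE.
by apply: ccvg_sum => k; apply: ccvgM.
Qed.

Lemma ccvg_uniq {PF : ProperFilter F} f l k : ccvg f l -> ccvg f k -> l = k.
Proof.
move=> [fr fi] [gr gi].
by apply: complexP; [apply: (cvg_unique _ fr gr)|apply: (cvg_unique _ fi gi)].
Qed.
End ComplexLimits.

Section Span.
Context {R : realType} {V : lmodType R[i]} (H : set V) (dot : V -> V -> R[i]).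
Hypothesis hH : hilbert H dot.
Local Notation nm := (nrm dot).
Local Notation n2 := (nrm2 dot).

Definition lincomb (I : Type) (g : I -> V) (r : seq (R[i] * I)) : V :=
  \sum_(x <- r) x.1 *: g x.2.

Definition span (I : Type) (g : I -> V) : set V := range (lincomb g).

Lemma lincomb_nil (I : Type) (g : I -> V) : lincomb g [::] = 0.
Proof. by rewrite /lincomb big_nil. Qed.

Lemma lincomb_cons (I : Type) (g : I -> V) x r :
  lincomb g (x :: r) = x.1 *: g x.2 + lincomb g r.
Proof. by rewrite /lincomb big_cons. Qed.

Lemma submodule_span (I : Type) (g : I -> V) : submodule (span g).
Proof.
split; first by exists [::]; rewrite ?lincomb_nil.
move=> a _ _ [r _ <-] [r' _ <-].
exists ([seq (a * x.1, x.2) | x <- r] ++ r') => //.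
rewrite /lincomb big_cat big_map scaler_sumr; congr (_ + _).
by apply: eq_bigr => x _; rewrite scalerA.
Qed.

Lemma lincombH (I : Type) (g : I -> V) r : (forall i, H (g i)) -> H (lincomb g r).
Proof.
move=> gH; elim: r => [|x r IH]; first by rewrite lincomb_nil; exact: hil0 hH.
by rewrite lincomb_cons; exact: hilP hH _ _ _ (gH _) IH.
Qed.

Lemma spanH (I : Type) (g : I -> V) : (forall i, H (g i)) -> span g `<=` H.
Proof. by move=> gH _ [r _ <-]; exact: lincombH. Qed.

Lemma dotZDl a x y z : H x -> H y -> H z ->
  dot (a *: x + y) z = (a^*)%C * dot x z + dot y z.
Proof.
move=> Hx Hy Hz; have Hxy := hilP hH a Hx Hy.
by rewrite (dotC hH Hz Hxy) (dotP hH)// rmorphD rmorphM/= -!(dotC hH).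
Qed.

Lemma perp_span (I : Type) (g : I -> V) : (forall i, H (g i)) ->
  perp H dot (span g) = [set w | H w /\ forall i, dot (g i) w = 0].
Proof.
move=> gH; apply/seteqP; split => w [Hw wL]; split=> //.
  move=> i; apply: wL; exists [:: (1, i)] => //.
  by rewrite lincomb_cons lincomb_nil scale1r addr0.
move=> _ [r _ <-]; elim: r => [|x r IH].
  by rewrite lincomb_nil (dot0l hH).
by rewrite lincomb_cons dotZDl ?wL ?mulr0 ?add0r//; exact: lincombH.
Qed.

(** ** Continuity *)

Lemma nrm_lt (x : V) (e : R) : H x -> 0 < e -> (nm x < e) = (n2 x < e ^+ 2).
Proof.
by move=> Hx e0; rewrite -(sqr_nrm hH)// ltr_sqr ?nnegrE ?nrm_ge0 ?(ltW e0).
Qed.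

(** Convergence in norm, for functions with values in [H]. *)
Definition vcvg {T : Type} (F : set_system T) (f : T -> V) (l : V) :=
  (fun t => nm (f t - l)) @ F --> (0 : R).

Lemma vcvgP {T : Type} (F : set_system T) {FF : Filter F} (f : T -> V) (l : V) :
  vcvg F f l <-> forall e, 0 < e -> \forall t \near F, nm (f t - l) < e.
Proof.
rewrite /vcvg; split=> [/cvgrPdist_lt h e e0|h].
  by apply: filterS (h _ e0) => t; rewrite sub0r normrN ger0_norm ?nrm_ge0.
apply/cvgrPdist_lt => e e0; apply: filterS (h _ e0) => t.
by rewrite sub0r normrN ger0_norm ?nrm_ge0.
Qed.

Lemma vcvg_cst {T : Type} (F : set_system T) {FF : Filter F} (l : V) :
  vcvg F (fun=> l) l.
Proof.
apply/vcvgP => e e0; apply: nearW => _.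
by rewrite subrr /nrm (nrm2_0 hH) sqrtr0.
Qed.

Lemma vcvgD {T : Type} (F : set_system T) {FF : Filter F} (f g : T -> V) (l k : V) :
  (forall t, H (f t)) -> (forall t, H (g t)) -> H l -> H k ->
  vcvg F f l -> vcvg F g k -> vcvg F (fun t => f t + g t) (l + k).
Proof.
move=> Hf Hg Hl Hk /vcvgP fl /vcvgP gk; have sH := submodule_hil hH.
apply/vcvgP => e e0; have e20 : 0 < e / 2 by rewrite divr_gt0.
apply: filterS2 (fl _ e20) (gk _ e20) => t ft gt; rewrite opprD addrACA.
apply: le_lt_trans (nrmD hH (submoduleB sH (Hf t) Hl) (submoduleB sH (Hg t) Hk)) _.
by rewrite [ltRHS]splitr ltrD.
Qed.

Lemma vcvgZ {T : Type} (F : set_system T) {FF : Filter F} (c : T -> R[i]) (a : R[i]) (x : V) :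
  H x -> (fun t => complex.Re (c t)) @ F --> complex.Re a ->
  (fun t => complex.Im (c t)) @ F --> complex.Im a ->
  vcvg F (fun t => c t *: x) (a *: x).
Proof.
move=> Hx cr ci; have sH := submodule_hil hH.
pose b t := Num.sqrt ((complex.Re (c t) - complex.Re a) ^+ 2 +
                      (complex.Im (c t) - complex.Im a) ^+ 2) * nm x.
have bE t : nm (c t *: x - a *: x) = b t.
  rewrite /nrm -scalerBl (nrm2Z hH)// sqrtrM ?addr_ge0 ?sqr_ge0//.
  by rewrite /b; case: (c t) => p q; case: (a) => p' q'.
rewrite /vcvg (_ : (fun t => _) = b); last by apply/funext.
have hr : (fun t => complex.Re (c t) - complex.Re a) @ F --> 0.
  by rewrite -[0](subrr (complex.Re a)); apply: cvgB => //; exact: cvg_cst.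
have hi : (fun t => complex.Im (c t) - complex.Im a) @ F --> 0.
  by rewrite -[0](subrr (complex.Im a)); apply: cvgB => //; exact: cvg_cst.
rewrite -[0](mul0r (nm x)); apply: cvgMr_tmp.
suff : (fun t => Num.sqrt ((complex.Re (c t) - complex.Re a) ^+ 2 +
    (complex.Im (c t) - complex.Im a) ^+ 2)) @ F --> Num.sqrt (0 : R).
  by rewrite sqrtr0.
apply: continuous_cvg; first exact: sqrt_continuous.
have -> : 0 = 0 * 0 + 0 * 0 :> R by rewrite mul0r addr0.
by apply: cvgD; [apply: (cvgM hr hr)|apply: (cvgM hi hi)].
Qed.

Lemma vcvg_dist {T : Type} (F : set_system T) {FF : Filter F} (f : T -> V) (l w : V) (a : R) :
  (forall t, H (f t)) -> H l -> H w -> vcvg F f l -> n2 (w - l) < a ->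
  \forall t \near F, n2 (w - f t) < a.
Proof.
move=> Hf Hl Hw /vcvgP fl la; have sH := submodule_hil hH.
have Hwl : H (w - l) by exact: submoduleB.
have a0 : 0 < a by apply: le_lt_trans la; exact: (nrm2_ge0 hH Hwl).
set r := Num.sqrt a; have r0 : 0 < r by rewrite sqrtr_gt0.
have ra : r ^+ 2 = a by rewrite sqr_sqrtr// ltW.
have lr : nm (w - l) < r by rewrite nrm_lt// ra.
have e0 : 0 < r - nm (w - l) by rewrite subr_gt0.
apply: filterS (fl _ e0) => t ft; rewrite -ra -nrm_lt//; last exact: submoduleB.
apply: le_lt_trans (nrmB3 hH Hw Hl (Hf t)) _.
by rewrite -ltrBrDl -(nrmN hH) ?opprB//; exact: submoduleB.
Qed.

Lemma vcvg_lincomb {T : Type} (F : set_system T) {FF : Filter F} (I : Type)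
    (g : T -> I -> V) (g0 : I -> V) r :
  (forall t i, H (g t i)) -> (forall i, H (g0 i)) ->
  (forall i, vcvg F (g^~ i) (g0 i)) ->
  vcvg F (fun t => lincomb (g t) r) (lincomb g0 r).
Proof.
move=> gH g0H gg; have sH := submodule_hil hH.
elim: r => [|x r IH].
  under eq_fun do rewrite lincomb_nil; rewrite lincomb_nil; exact: vcvg_cst.
under eq_fun do rewrite lincomb_cons; rewrite lincomb_cons.
apply: vcvgD => //.
- by move=> t; exact: submoduleZ.
- by move=> t; exact: lincombH.
- exact: submoduleZ.
- exact: lincombH.
pose n := Num.sqrt (complex.Re x.1 ^+ 2 + complex.Im x.1 ^+ 2).
rewrite /vcvg (_ : (fun t => _) = (fun t => n * nm (g t x.2 - g0 x.2))).
  by rewrite -[0](mulr0 n); apply: cvgMl_tmp; exact: gg.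
apply/funext => t; rewrite -scalerBr /nrm (nrm2Z hH); last exact: submoduleB.
by rewrite sqrtrM ?addr_ge0 ?sqr_ge0.
Qed.

Lemma vcvg_lincomb_coef {T : Type} (F : set_system T) {FF : Filter F} (I : Type)
    (g : I -> V) (c : T -> I -> R[i]) (c0 : I -> R[i]) (r : seq I) :
  (forall i, H (g i)) -> (forall i, ccvg F (c^~ i) (c0 i)) ->
  vcvg F (fun t => lincomb g [seq (c t i, i) | i <- r])
         (lincomb g [seq (c0 i, i) | i <- r]).
Proof.
move=> gH cc; have sH := submodule_hil hH.
elim: r => [|i r IH]; first by rewrite /= lincomb_nil; exact: vcvg_cst.
rewrite /= lincomb_cons /=; under eq_fun do rewrite lincomb_cons /=.
have HZ a : H (a *: g i) by exact: submoduleZ.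
apply: (vcvgD (fun t => HZ (c t i)) (fun t => lincombH _ gH) (HZ _) (lincombH _ gH) _ IH).
by have [cr ci] := cc i; exact: vcvgZ.
Qed.

(** The distance to the span of a continuously varying family is an infimum of
    continuous functions, hence upper semicontinuous. *)
Lemma dist2_usc {T : topologicalType} (I : Type) (g : T -> I -> V) w (a : R) :
  (forall t i, H (g t i)) -> (forall t i, vcvg (nbhs t) (g^~ i) (g t i)) ->
  H w -> open [set t | dist2 dot (span (g t)) w < a].
Proof.
move=> gH gc Hw; rewrite openE => t /=.
move=> /(dist2_gt hH (submodule_span (g t)) (spanH (gH t)) Hw)[_ [r _ <-] ra].
have fr := @vcvg_lincomb _ _ (nbhs_filter t) _ _ _ r gH (gH t) (gc t).
have := @vcvg_dist _ _ (nbhs_filter t) _ _ _ _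
  (fun t' => lincombH r (gH t')) (lincombH r (gH t)) Hw fr ra.
apply: filterS => t' /=; apply: le_lt_trans.
apply: (dist2_le hH (submodule_span _) (spanH (gH t')) Hw).
by exists r.
Qed.

(** ** Density *)

Section dense.
Variables (I : Type) (e : I -> V).
Hypotheses (eH : forall i, H (e i))
  (total : forall w, H w -> (forall i, dot (e i) w = 0) -> w = 0).

Definition qlincomb (r : seq (rat * rat * I)) : V :=
  lincomb e [seq (Complex (ratr x.1.1) (ratr x.1.2), x.2) | x <- r].

Lemma qlincombH r : H (qlincomb r).
Proof. exact: lincombH. Qed.

Lemma rat_approx (x : R) (d : R) : 0 < d -> exists q : rat, `|x - ratr q| < d.
Proof.
move=> d0; have /rat_in_itvoo[q] : x - d < x + d by lra.
rewrite in_itv/= => /andP[q1 q2]; exists q.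
by rewrite ltr_norml; apply/andP; split; lra.
Qed.

Lemma qlincomb_approx r (d : R) : 0 < d ->
  exists q, nm (lincomb e r - qlincomb q) < d.
Proof.
have sH := submodule_hil hH.
elim: r d => [|x r IH] d d0.
  by exists [::]; rewrite /qlincomb lincomb_nil subrr /nrm (nrm2_0 hH) sqrtr0.
have [q hq] := IH (d / 2) (divr_gt0 d0 (ltr0n _ 2)).
set y := e x.2; have n0 := nrm_ge0 dot y.
(* Coefficients that are off by less than this in both parts change the term
   of [y] by less than [d / 2]. *)
have c0 : 0 < d / (4 * (nm y + 1)) by rewrite divr_gt0// mulr_gt0//; lra.
have [p hp] := rat_approx (complex.Re x.1) c0.
have [p' hp'] := rat_approx (complex.Im x.1) c0.
exists ((p, p', x.2) :: q); rewrite /qlincomb /= !lincomb_cons /= -/(qlincomb q).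
rewrite opprD addrACA -scalerBl.
have Hy : H y by exact: eH.
have Hz a : H (a *: y) by exact: submoduleZ.
apply: le_lt_trans (nrmD hH (Hz _) (submoduleB sH (lincombH r eH) (qlincombH q))) _.
rewrite [ltRHS]splitr; apply: ler_ltD => //.
rewrite -ler_sqr ?nnegrE ?nrm_ge0 ?divr_ge0 ?(ltW d0)// (sqr_nrm hH)// (nrm2Z hH)//.
rewrite -(sqr_nrm hH)//.
set b := d / (4 * (nm y + 1)) in c0 hp hp'.
have le u : `|u| < b -> u ^+ 2 <= b ^+ 2.
  move=> ub; rewrite -[u ^+ 2]real_normK ?num_real//.
  by rewrite ler_sqr ?nnegrE ?(ltW c0)// ltW.
apply: (@le_trans _ _ ((b ^+ 2 + b ^+ 2) * nm y ^+ 2)).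
  apply: ler_wpM2r; first exact: sqr_ge0.
  by case: (x.1) hp hp' => u v /= /le h1 /le h2; apply: lerD.
have -> : (d / 2) ^+ 2 = b ^+ 2 * ((nm y + 1) * 2) ^+ 2.
  by rewrite /b; field; rewrite gt_eqF//; lra.
rewrite [leLHS](_ : _ = b ^+ 2 * (2 * nm y ^+ 2)); last by ring.
apply: ler_wpM2l; first exact: sqr_ge0.
rewrite -subr_ge0 [X in 0 <= X](_ : _ = 2 * nm y ^+ 2 + 8 * nm y + 4); last by ring.
by rewrite !addr_ge0 ?mulr_ge0 ?sqr_ge0.
Qed.

(** When the orthogonal complement of the family is trivial, the projection theorem
    gives every vector distance 0 to the span; rational coefficients then
    suffice. *)
Lemma qlincomb_dense x (d : R) : H x -> 0 < d -> exists q, nm (x - qlincomb q) < d.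
Proof.
move=> Hx d0; have sH := submodule_hil hH; have LH := spanH eH.
have d20 : 0 < d / 2 by rewrite divr_gt0.
have [g [gL _ gD]] := proj_exists hH (submodule_span e) LH Hx.
move: gL; rewrite perp_span// => -[Hg /(total Hg) g0].
have : dist2 dot (span e) x < (d / 2) ^+ 2.
  by rewrite -gD g0 (nrm2_0 hH) exprn_gt0.
move=> /(dist2_gt hH (submodule_span e) LH Hx)[_ [r _ <-] xr].
have Hr := lincombH r eH; have [q hq] := qlincomb_approx r d20.
exists q; apply: le_lt_trans (nrmB3 hH Hx Hr (qlincombH q)) _.
by rewrite [ltRHS]splitr ltrD// nrm_lt//; exact: submoduleB.
Qed.
End dense.
End Span.

(** * The graph of a state-space model *)

Section ProductHilbert.
Context {R : realType} {V1 V2 : lmodType R[i]}.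
Variables (H1 : set V1) (d1 : V1 -> V1 -> R[i]) (H2 : set V2) (d2 : V2 -> V2 -> R[i]).
Hypotheses (h1 : hilbert H1 d1) (h2 : hilbert H2 d2).

Lemma hilbert_prod : hilbert (H1 `*` H2) (fun w z => d1 w.1 z.1 + d2 w.2 z.2).
Proof.
have nE w : nrm2 (fun w z => d1 w.1 z.1 + d2 w.2 z.2) w = nrm2 d1 w.1 + nrm2 d2 w.2.
  by rewrite /nrm2 ReD.
have s1 := submodule_hil h1; have s2 := submodule_hil h2.
split.
- by split; [exact: hil0 h1|exact: hil0 h2].
- by move=> a x y [x1 x2] [y1 y2]; split; [exact: (hilP h1)|exact: (hilP h2)].
- move=> a x y z [x1 x2] [y1 y2] [z1 z2] /=.
  by rewrite (dotP h1)// (dotP h2)// mulrDr addrACA.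
- by move=> x y [x1 x2] [y1 y2]; rewrite (dotC h1 x1 y1) (dotC h2 x2 y2) rmorphD.
- by move=> x [x1 x2]; rewrite nE addr_ge0 ?(nrm2_ge0 h1) ?(nrm2_ge0 h2).
- move=> [x x'] [/= x1 x2]; rewrite nE /= => /eqP.
  rewrite paddr_eq0 ?(nrm2_ge0 h1) ?(nrm2_ge0 h2)// => /andP[/eqP n1 /eqP n2].
  by rewrite (nrm2_eq0 h1 x1 n1) (nrm2_eq0 h2 x2 n2).
move=> u uH cauchy.
have u1 n := (uH n).1; have u2 n := (uH n).2.
have [|x Hx hx] := hilcomplete h1 u1.
  move=> e /cauchy[N hN]; exists N => i j Ni Nj; apply: le_lt_trans (hN i j Ni Nj).
  by rewrite nE lerDl; apply: (nrm2_ge0 h2); exact: (submoduleB s2 (u2 i) (u2 j)).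
have [|y Hy hy] := hilcomplete h2 u2.
  move=> e /cauchy[N hN]; exists N => i j Ni Nj; apply: le_lt_trans (hN i j Ni Nj).
  by rewrite nE lerDr; apply: (nrm2_ge0 h1); exact: (submoduleB s1 (u1 i) (u1 j)).
exists (x, y) => // e e0; have e20 : 0 < e / 2 by rewrite divr_gt0.
have [N1 k1] := hx _ e20; have [N2 k2] := hy _ e20.
exists (maxn N1 N2) => i; rewrite geq_max => /andP[i1 i2].
by rewrite nE [ltRHS]splitr ltrD ?k1 ?k2.
Qed.
End ProductHilbert.

Section Plants.
Context {R : realType} {n m l : nat}.
Local Notation C := R[i].
Local Notation model := (model R n m l).
Local Notation V1 := (C -> 'cV[C]_m).
Local Notation V2 := (C -> 'cV[C]_l).
Local Notation io := (V1 * V2)%type.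
Local Notation H := (@io_space R m l).
Local Notation dot := (@io_dot R m l).
Implicit Types (S : model) (s : C) (w : io).

Lemma io_hilbert : hilbert H dot.
Proof. exact: (hilbert_prod (H2_hilbert m) (H2_hilbert l)). Qed.

Definition charmx S s : 'M[C]_n := s%:M - map_mx (real_complex R) S.1.1.

(** Away from the eigenvalues of [A], the transfer matrix is [TF_num S s] divided
    by [TF_den S s].  Both are polynomials in the entries of the model, hence
    continuous in it. *)
Definition TF_den S s : C := \det (charmx S s).
Definition TF_num S s : 'M[C]_(l, m) :=
  map_mx (real_complex R) S.2 *m \adj (charmx S s) *m map_mx (real_complex R) S.1.2.

Lemma TF_frac S s : TF_den S s != 0 -> TF S s = (TF_den S s)^-1 *: TF_num S s.
Proof.
case: S => [[A B] K] dN0; rewrite /TF /TF_num /= /invmx unitmxE unitfE.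
rewrite -[s%:M - _]/(charmx (A, B, K) s) -/(TF_den _ s) dN0.
by rewrite -scalemxAr -scalemxAl.
Qed.

Lemma TF_den_horner S s : TF_den S s = (char_poly (map_mx (real_complex R) S.1.1)).[s].
Proof.
rewrite /char_poly -[RHS]/(horner_eval s _) -det_map_mx; congr (\det _).
by apply/matrixP => i j; rewrite !mxE /= /horner_eval hornerD hornerN hornerMn hornerX hornerC.
Qed.

Lemma TF_den_roots S : exists Z : seq C, forall s, TF_den S s = 0 -> s \in Z.
Proof.
have [Z ZE] := closed_field_poly_normal (char_poly (map_mx (real_complex R) S.1.1)).
move: ZE; rewrite (monicP (char_poly_monic _)) scale1r => ZE.
exists Z => s; rewrite TF_den_horner ZE => /eqP.
by rewrite -rootE root_prod_XsubC.
Qed.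

Lemma charmx_ccvg_s S s i j : ccvg \oo
  (fun k : nat => charmx S (s + (k.+1%:R^-1)%:C%C) i j) (charmx S s i j).
Proof.
rewrite !mxE; under eq_fun do rewrite !mxE.
apply: ccvgD; last exact: ccvg_cst.
have sc : ccvg \oo (fun k : nat => s + (k.+1%:R^-1 : R)%:C%C) s.
  rewrite -[X in ccvg _ _ X]addr0; apply: ccvgD; first exact: ccvg_cst.
  by split=> /=; [exact: cvg_harmonic|exact: cvg_cst].
rewrite -mulr_natr; under eq_fun do rewrite -[_ *+ (i == j)]mulr_natr.
by apply: ccvgM; [exact: sc|exact: ccvg_cst].
Qed.

Lemma entry_continuous S :
  [/\ forall i j, (fun S' : model => S'.1.1 i j) @ S --> S.1.1 i j,
      forall i j, (fun S' : model => S'.1.2 i j) @ S --> S.1.2 i j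
    & forall i j, (fun S' : model => S'.2 i j) @ S --> S.2 i j].
Proof.
split=> i j.
- apply: (@cvg_comp _ _ _ (fun S' : model => S'.1.1) (fun A : 'M[R]_n => A i j) _ (nbhs S.1.1)).
    by apply: (@cvg_comp _ _ _ fst fst _ (nbhs S.1)); exact: cvg_fst.
  exact: coord_continuous.
- apply: (@cvg_comp _ _ _ (fun S' : model => S'.1.2)
    (fun A : 'M[R]_(n, m) => A i j) _ (nbhs S.1.2)).
    by apply: (@cvg_comp _ _ _ fst snd _ (nbhs S.1)); [exact: cvg_fst|exact: cvg_snd].
  exact: coord_continuous.
- apply: (@cvg_comp _ _ _ (fun S' : model => S'.2) (fun A : 'M[R]_(l, n) => A i j) _ (nbhs S.2)).
    exact: cvg_snd.
  exact: coord_continuous.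
Qed.

Lemma ccvg_real {T : Type} (F : set_system T) {FF : Filter F} (f : T -> R) (x : R) :
  f @ F --> x -> ccvg F (fun t => (f t)%:C%C) (x%:C%C).
Proof. by move=> fx; split=> //=; exact: cvg_cst. Qed.

Lemma charmx_ccvg_S S s i j :
  ccvg (nbhs S) (fun S' : model => charmx S' s i j) (charmx S s i j).
Proof.
rewrite !mxE; under eq_fun do rewrite !mxE.
apply: ccvgD; first exact: ccvg_cst.
by apply: ccvgN; apply: ccvg_real; have [] := entry_continuous S.
Qed.

Lemma TF_den_ccvg_S S s : ccvg (nbhs S) (fun S' : model => TF_den S' s) (TF_den S s).
Proof. by apply: ccvg_det => i j; exact: charmx_ccvg_S. Qed.

Lemma TF_num_ccvg_S S s i j :
  ccvg (nbhs S) (fun S' : model => TF_num S' s i j) (TF_num S s i j).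
Proof.
have [cA cB cK] := entry_continuous S.
apply: ccvg_mulmx => a b; last first.
  by rewrite mxE; under eq_fun do rewrite mxE; exact: ccvg_real.
apply: ccvg_mulmx => c d.
  by rewrite mxE; under eq_fun do rewrite mxE; exact: ccvg_real.
by apply: ccvg_adj => *; exact: charmx_ccvg_S.
Qed.

Lemma TF_den_ccvg_s S s : ccvg \oo (fun k : nat => TF_den S (s + (k.+1%:R^-1)%:C%C)) (TF_den S s).
Proof. by apply: ccvg_det => i j; exact: charmx_ccvg_s. Qed.

Lemma TF_num_ccvg_s S s i j :
  ccvg \oo (fun k : nat => TF_num S (s + (k.+1%:R^-1)%:C%C) i j) (TF_num S s i j).
Proof.
apply: ccvg_mulmx => a b; last exact: ccvg_cst.
apply: ccvg_mulmx => c d; first exact: ccvg_cst.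
by apply: ccvg_adj => *; exact: charmx_ccvg_s.
Qed.

Lemma shift_avoids (Z : seq C) s :
  exists N, forall k : nat, (N <= k)%N -> s + (k.+1%:R^-1 : R)%:C%C \notin Z.
Proof.
elim: Z => [|z Z [N hN]]; first by exists 0%N.
have [[k kz]|nz] := pselect (exists k : nat, s + (k.+1%:R^-1 : R)%:C%C = z).
  exists (maxn N k.+1) => j; rewrite geq_max => /andP[Nj kj].
  rewrite inE negb_or hN// andbT -kz; apply/eqP => /addrI /complexI /invr_inj /eqP.
  by rewrite eqr_nat eqSS => /eqP jk; rewrite jk ltnn in kj.
exists N => k Nk; rewrite inE negb_or hN// andbT.
by apply/eqP => kz; apply: nz; exists k.
Qed.

(** Clearing the denominator removes the exceptional points: both sides are
    continuous in [s], and a finite set is avoided by points tending to [s]. *)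
Lemma graph_TF S : graph (TF S) = [set w | H w /\ forall s j, 0 < complex.Re s ->
  TF_den S s * w.2 s j 0 = \sum_i TF_num S s j i * w.1 s i 0].
Proof.
have [Z ZP] := TF_den_roots S.
apply/seteqP; split => [w [Hw [E wE]]|w [Hw wE]]; split=> //; last first.
  exists Z => s s0 /negP sZ; have dN0 : TF_den S s != 0 by apply/eqP => /ZP.
  rewrite TF_frac// -scalemxAl; apply/colP => j; rewrite !mxE -wE//.
  by rewrite mulKf.
move=> s j s0; pose sk k : C := s + (k.+1%:R^-1 : R)%:C%C.
have sk0 k : 0 < complex.Re (sk k) by rewrite ReD /= addr_gt0// invr_gt0.
have c2 : ccvg \oo (fun k => TF_den S (sk k) * w.2 (sk k) j 0) (TF_den S s * w.2 s j 0).
  by apply: ccvgM; [exact: TF_den_ccvg_s|exact: (H2_shift_cvg j Hw.2 s0)].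
have c1 : ccvg \oo (fun k => \sum_i TF_num S (sk k) j i * w.1 (sk k) i 0)
    (\sum_i TF_num S s j i * w.1 s i 0).
  by apply: ccvg_sum => i; apply: ccvgM; [exact: TF_num_ccvg_s|exact: (H2_shift_cvg i Hw.1 s0)].
have [N hN] := shift_avoids (E ++ Z) s.
have eqk k : (N <= k)%N -> TF_den S (sk k) * w.2 (sk k) j 0 =
    \sum_i TF_num S (sk k) j i * w.1 (sk k) i 0.
  move=> /hN; rewrite mem_cat negb_or => /andP[kE kZ].
  have dN0 : TF_den S (sk k) != 0 by apply: contra kZ => /eqP /ZP.
  rewrite wE// TF_frac// -scalemxAl !mxE mulVKf//.
apply: (ccvg_uniq c2); split.
  apply: cvg_trans c1.1; apply: near_eq_cvg; near=> k; congr complex.Re.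
  by rewrite eqk//; near: k; exact: nbhs_infty_ge.
apply: cvg_trans c1.2; apply: near_eq_cvg; near=> k; congr complex.Im.
by rewrite eqk//; near: k; exact: nbhs_infty_ge.
Unshelve. all: by end_near. Qed.

Local Notation point := {s : C | 0 < complex.Re s}.

Definition kernel1 s (i : 'I_m) : io := (kernel s i, 0).
Definition kernel2 s (j : 'I_l) : io := (0, kernel s j).

Lemma H_kernel1 s i : 0 < complex.Re s -> H (kernel1 s i).
Proof. by move=> s0; split; [exact: H2_kernel|exact: hil0 (H2_hilbert l)]. Qed.

Lemma H_kernel2 s j : 0 < complex.Re s -> H (kernel2 s j).
Proof. by move=> s0; split; [exact: hil0 (H2_hilbert m)|exact: H2_kernel]. Qed.

Lemma dot_kernel1 s i w : 0 < complex.Re s -> H w -> dot (kernel1 s i) w = w.1 s i 0.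
Proof.
move=> s0 [w1 w2]; rewrite /io_dot /= kernelP//.
by rewrite (dot0l (H2_hilbert l))// addr0.
Qed.

Lemma dot_kernel2 s j w : 0 < complex.Re s -> H w -> dot (kernel2 s j) w = w.2 s j 0.
Proof.
move=> s0 [w1 w2]; rewrite /io_dot /= kernelP//.
by rewrite (dot0l (H2_hilbert m))// add0r.
Qed.

(** The scalar product of this vector with [(u, y)] is the coordinate [j] of
    [p(s) y(s) - Q(s) u(s)], for [x = (s, j)]; conjugates appear because the
    scalar product is conjugate linear in its first argument. *)
Definition graph_normal S (x : point * 'I_l) : io :=
  lincomb (kernel1 (val x.1)) [seq (- (TF_num S (val x.1) x.2 i)^*%C, i) | i <- enum 'I_m]
  + (TF_den S (val x.1))^*%C *: kernel2 (val x.1) x.2.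

Lemma H_graph_normal S x : H (graph_normal S x).
Proof.
have sH := submodule_hil io_hilbert; have x0 := valP x.1.
apply: submoduleD => //; last by apply: submoduleZ => //; exact: H_kernel2.
by apply: (lincombH io_hilbert) => i; exact: H_kernel1.
Qed.

Lemma dot_lincomb (I : Type) (g : I -> io) r w : (forall i, H (g i)) -> H w ->
  dot (lincomb g r) w = \sum_(x <- r) (x.1^*)%C * dot (g x.2) w.
Proof.
move=> gH Hw; elim: r => [|x r IH].
  by rewrite lincomb_nil big_nil (dot0l io_hilbert).
rewrite lincomb_cons big_cons -IH (dotZDl io_hilbert)//.
exact: (lincombH io_hilbert).
Qed.

Lemma dot_graph_normal S x w : H w -> dot (graph_normal S x) w =
  TF_den S (val x.1) * w.2 (val x.1) x.2 0 -
  \sum_i TF_num S (val x.1) x.2 i * w.1 (val x.1) i 0.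
Proof.
move=> Hw; have x0 := valP x.1; have hH := io_hilbert.
have Hk := H_kernel2 x.2 x0.
rewrite /graph_normal addrC (dotZDl hH)//; last first.
  by apply: (lincombH hH) => i; exact: H_kernel1.
rewrite conjcK dot_kernel2//; congr (_ + _).
rewrite dot_lincomb//; last by move=> i; exact: H_kernel1.
rewrite big_map big_enum -sumrN; apply: eq_bigr => i _ /=.
by rewrite rmorphN /= conjcK dot_kernel1// mulNr.
Qed.

Lemma graph_perp S : graph (TF S) = perp H dot (span (graph_normal S)).
Proof.
rewrite graph_TF (perp_span io_hilbert (H_graph_normal S)).
apply/seteqP; split => w [Hw wE]; split=> //.
  by move=> x; rewrite dot_graph_normal// wE ?subrr//; exact: (valP x.1).
move=> s j s0; have := wE (exist _ s s0, j); rewrite dot_graph_normal//= => /eqP.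
by rewrite subr_eq0 => /eqP.
Qed.

Lemma graph_normal_cvg S x : vcvg dot (nbhs S) (graph_normal^~ x) (graph_normal S x).
Proof.
have hH := io_hilbert; have sH := submodule_hil hH; have x0 := valP x.1.
have Hl S' : H (lincomb (kernel1 (val x.1))
    [seq (- (TF_num S' (val x.1) x.2 i)^*%C, i) | i <- enum 'I_m]).
  by apply: (lincombH hH) => i; exact: H_kernel1.
have Hk := H_kernel2 x.2 x0.
have HkZ a : H (a *: kernel2 (val x.1) x.2) by exact: submoduleZ.
apply: (vcvgD hH Hl _ (Hl S) (HkZ _)); first by move=> S'; exact: HkZ.
  apply: (vcvg_lincomb_coef hH) => i; first exact: H_kernel1.
  exact: ccvgN (ccvg_conj (TF_num_ccvg_S S (val x.1) x.2 i)).
have [cr ci] := ccvg_conj (TF_den_ccvg_S S (val x.1)).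
exact: (vcvgZ hH Hk cr ci).
Qed.
End Plants.

(** * Measurability of the gap *)

Section GapMeasurable.
Context {R : realType} {n m l : nat}.
Local Notation C := R[i].
Local Notation model := (model R n m l).
Local Notation io := ((C -> 'cV[C]_m) * (C -> 'cV[C]_l))%type.
Local Notation H := (@io_space R m l).
Local Notation dot := (@io_dot R m l).
Local Notation P := (fun S : model => orthproj (graph (TF S))).
Implicit Types (S : model) (w : io).

Let hH : hilbert H dot := io_hilbert.
Let sL S := submodule_span (graph_normal S).
Let LH S := spanH hH (H_graph_normal S).

Lemma orthproj_projects S : projects H dot (perp H dot (span (graph_normal S))) (P S).
Proof.
move=> w Hw; have [g [gG gP _]] := proj_exists hH (sL S) (@LH S) Hw.
rewrite /orthproj graph_perp.
by case: xgetP => [g' _ [] //|/(_ g)[]]; split.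
Qed.

Lemma delta_gE S S' : delta_g S S' = gap H dot (P S) (P S').
Proof. by []. Qed.

Lemma delta_g_ge0 S S' : 0 <= delta_g S S'.
Proof.
rewrite delta_gE.
exact: (gap_ge0 hH (sL S) (@LH S) (sL S') (@LH S') (orthproj_projects S) (orthproj_projects S')).
Qed.

Lemma delta_g_le2 S S' : delta_g S S' <= 2.
Proof.
rewrite delta_gE.
exact: (gap_le2 hH (sL S) (@LH S) (sL S') (@LH S') (orthproj_projects S) (orthproj_projects S')).
Qed.

Lemma delta_g_sym S S' : delta_g S S' = delta_g S' S.
Proof.
by rewrite !delta_gE; apply: (gap_sym hH) => w Hw;
  exact: (projH (orthproj_projects _) Hw).
Qed.

Lemma delta_g_triangle S1 S2 S3 : delta_g S1 S3 <= delta_g S1 S2 + delta_g S2 S3.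
Proof.
rewrite !delta_gE.
exact: (gap_triangle hH (sL S1) (@LH S1) (sL S2) (@LH S2) (sL S3) (@LH S3)
  (orthproj_projects S1) (orthproj_projects S2) (orthproj_projects S3)).
Qed.

Lemma measurable_borel (T : ptopologicalType) (U : set T) :
  open U -> measurable (U : set (borel T)).
Proof. by move=> oU; apply: sub_sigma_algebra. Qed.

(** Upper semicontinuity: the squared norm is the squared distance to the span of
    a continuous family. *)
Lemma nrm2_proj_measurable w : H w ->
  measurable_fun setT (fun S : borel model => nrm2 dot (P S w)).
Proof.
move=> Hw _; apply: (measurability _ (RGenInftyO.measurableE R)) => //.
move=> /= _ [_ [a ->] <-]; rewrite setTI.
rewrite (_ : _ @^-1` _ = [set S : model | dist2 dot (span (graph_normal S)) w < a]).
  apply: measurable_borel; apply: (dist2_usc hH) => //; first exact: H_graph_normal.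
  exact: graph_normal_cvg.
apply/seteqP; split=> S /=; rewrite in_itv/=;
by rewrite (proj_dist2 hH (sL S) (@LH S) (orthproj_projects S)).
Qed.

Lemma rdot_proj_measurable x w : H x -> H w ->
  measurable_fun setT (fun S : borel model => rdot dot x (P S w)).
Proof.
move=> Hx Hw; have sH := submodule_hil hH.
rewrite (_ : (fun S => _) = (fun S : borel model =>
    (nrm2 dot (P S (x + w)) - nrm2 dot (P S (x - w))) * 4^-1)).
  apply: measurable_funM => //; apply: measurable_funB; apply: nrm2_proj_measurable.
    exact: submoduleD.
  exact: submoduleB.
by apply/funext => S; rewrite (proj_polar hH (@LH S) (orthproj_projects S)).
Qed.

Lemma nrm2_diff_measurable S0 w : H w ->
  measurable_fun setT (fun S : borel model => nrm2 dot (P S0 w - P S w)).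
Proof.
move=> Hw; have HP S := projH (orthproj_projects S) Hw.
rewrite (_ : (fun S => _) = (fun S : borel model => nrm2 dot (P S0 w) -
    rdot dot (P S0 w) (P S w) * 2 + nrm2 dot (P S w))).
  apply: measurable_funD; last exact: nrm2_proj_measurable.
  apply: measurable_funB => //; apply: measurable_funM => //.
  exact: (rdot_proj_measurable (HP S0) Hw).
by apply/funext => S; rewrite (nrm2B hH (HP S0) (HP S)) mulr_natr.
Qed.

Definition int_point (n : nat) : C := n.+1%:R.

Lemma int_point_gt0 k : 0 < complex.Re (int_point k).
Proof. by rewrite /int_point -(rmorph_nat (real_complex R)) /= ltr0n. Qed.

Definition int_kernel (x : nat * ('I_m + 'I_l)) : io :=
  match x.2 with
  | inl i => kernel1 (int_point x.1) i
  | inr j => kernel2 (int_point x.1) j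
  end.

Lemma H_int_kernel x : H (int_kernel x).
Proof.
case: x => k [i|j]; [exact: (H_kernel1 i (int_point_gt0 k))|].
exact: (H_kernel2 j (int_point_gt0 k)).
Qed.

(** By Lerch's theorem a transform is determined by its values at the positive
    integers. *)
Lemma int_kernel_total w : H w -> (forall x, dot (int_kernel x) w = 0) -> w = 0.
Proof.
move=> Hw w0; have [w1 w2] := Hw.
have h0 k : H2 R k 0 := hil0 (H2_hilbert k).
rewrite [w]surjective_pairing; congr pair; apply: H2_inj => // k; apply/colP => i.
  have := w0 (k, inl i); rewrite /int_kernel /= dot_kernel1 ?int_point_gt0// => ->.
  by rewrite mxE.
have := w0 (k, inr i); rewrite /int_kernel /= dot_kernel2 ?int_point_gt0// => ->.
by rewrite mxE.
Qed.

(** The set where the gap exceeds [a] is a countable union, over rational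
    combinations of the kernels at the integers, of sets given by the measurable
    functions of [nrm2_diff_measurable]. *)
Lemma measurable_delta_g S0 :
  measurable_fun setT (fun S : borel model => delta_g S0 S).
Proof.
move=> _; apply: (measurability _ (RGenOInfty.measurableE R)) => //.
move=> /= _ [_ [a ->] <-]; rewrite setTI.
have [a0|a0] := ltP a 0.
  rewrite (_ : _ @^-1` _ = setT); first exact: measurableT.
  apply/seteqP; split=> // S _ /=; rewrite in_itv/= andbT.
  exact: lt_le_trans a0 (delta_g_ge0 _ _).
pose W q := qlincomb int_kernel q.
have HW q : H (W q) by exact: (qlincombH hH H_int_kernel).
pose A (o : option (seq (rat * rat * (nat * ('I_m + 'I_l))))) : set (borel model) :=
  if o is Some q
  then [set S | a ^+ 2 * nrm2 dot (W q) < nrm2 dot (P S0 (W q) - P S (W q))]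
  else set0.
rewrite (_ : _ @^-1` _ = \bigcup_(k : nat) A (unpickle k)).
  apply: bigcupT_measurable => k; case: (unpickle k) => [q|]; last exact: measurable0.
  have := nrm2_diff_measurable S0 (HW q) measurableT
    (measurable_itv `]a ^+ 2 * nrm2 dot (W q), +oo[).
  rewrite setTI; congr measurable; apply/seteqP; split=> S /=;
  by rewrite in_itv/= andbT.
have dense x (e : R) : H x -> 0 < e -> exists2 y, range W y & nrm dot (x - y) < e.
  move=> Hx e0; have [q hq] := qlincomb_dense hH H_int_kernel int_kernel_total Hx e0.
  by exists (W q) => //; exists q.
have key S : a < delta_g S0 S <-> exists2 w, range W w &
    a ^+ 2 * nrm2 dot w < nrm2 dot (P S0 w - P S w).
  rewrite delta_gE; apply: (gap_gtP hH a0 (sL S0) (@LH S0) (sL S) (@LH S)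
    (orthproj_projects S0) (orthproj_projects S) _ dense).
  by move=> _ [q _ <-].
apply/seteqP; split=> S.
  rewrite /= in_itv/= andbT => /key[_ [q _ <-] qS].
  have AS : A (unpickle (pickle q)) S by rewrite pickleK.
  by exists (pickle q); [exact: Logic.I|exact: AS].
move=> [k _]; case: (unpickle k) => [q|] qS; last by case: qS.
by rewrite /= in_itv/= andbT; apply/key; exists (W q) => //; exists q.
Qed.
End GapMeasurable.

(** * Supports have full measure *)

Section Support.
Context {R : realType}.

Lemma countable_ball_basis {T : pseudoMetricType R} {I : Type} (D : I -> T) :
  (forall (x : T) (e : R), 0 < e -> exists k, ball (D k) e x) ->
  forall (U : set T) x, open U -> U x ->
  exists k : I * nat, (ball (D k.1) (k.2.+1%:R^-1 : R))° x /\
    (ball (D k.1) (k.2.+1%:R^-1 : R))° `<=` U.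
Proof.
move=> dense U x oU Ux.
have /nbhs_ballP[e /= e0 eU] : nbhs x U by exact: open_nbhs_nbhs.
have e20 : 0 < e / 2 by rewrite divr_gt0.
have [N _ hN] := near_infty_natSinv_lt (PosNum e20).
have /= rN := hN N (leqnn N); set r : R := N.+1%:R^-1 in rN.
have r0 : 0 < r by rewrite invr_gt0.
have r20 : 0 < r / 2 by rewrite divr_gt0.
have [k xk] := dense x _ r20; exists (k, N); split.
  apply/nbhs_ballP; exists (r / 2) => //= y xy.
  by rewrite -/r [r]splitr; exact: ball_triangle xk xy.
move=> y /interior_subset /= ky; apply: eU.
apply: (@le_ball _ _ _ (r / 2 + r)); first by lra.
exact: ball_triangle (ball_sym xk) ky.
Qed.

Section basis.
Context {T : ptopologicalType} {K : countType} (W : K -> set T).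
Hypotheses (openW : forall k, open (W k)) (basisW : forall U x, open U -> U x ->
  exists k, W k x /\ W k `<=` U).

Variable f : probability (borel T) R.

Let null_basic (i : nat) : set (borel T) :=
  if unpickle i is Some k then (if f (W k) == 0%E then W k else set0) else set0.

Lemma measurable_null_basic i : measurable (null_basic i).
Proof.
rewrite /null_basic; case: (unpickle i) => [k|]; last exact: measurable0.
case: ifP => _; last exact: measurable0.
by apply: measurable_borel; exact: openW.
Qed.

Lemma null_basic0 i : f (null_basic i) = 0%E.
Proof.
rewrite /null_basic; case: (unpickle i) => [k|]; last by rewrite measure0.
by case: ifPn => [/eqP//|_]; rewrite measure0.
Qed.

(** A point outside the support has a null neighbourhood, which contains a null
    basic open set around the point. *)
Lemma suppC : ~` supp f = \bigcup_i null_basic i.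
Proof.
apply/seteqP; split=> [x xs|x [i _ ix] xs].
  have [U [oU Ux fU]] : exists U, [/\ open U, U x & f U = 0%E].
    apply: contrapT => nU; apply: xs => U oU Ux.
    rewrite lt_neqAle measure_ge0 andbT; apply/eqP => fU.
    by apply: nU; exists U.
  have [k [Wx WU]] := basisW oU Ux.
  have fW : f (W k) = 0%E.
    apply/eqP; rewrite eq_le measure_ge0 andbT -fU; apply: le_measure => //;
    by rewrite inE; apply: measurable_borel.
  have kx : null_basic (pickle k) x by rewrite /null_basic pickleK fW eqxx.
  by exists (pickle k); [exact: Logic.I|exact: kx].
move: ix; rewrite /null_basic; case: (unpickle i) => [k|//]; case: ifP => // /eqP fk Wx.
by have := xs (W k) (openW k) Wx; rewrite fk ltxx.
Qed.

Lemma measurable_suppC : measurable (~` supp f : set (borel T)).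
Proof. by rewrite suppC; apply: bigcupT_measurable => i; exact: measurable_null_basic. Qed.

Lemma suppC0 : f (~` supp f) = 0%E.
Proof.
have : f.-negligible (~` supp f : set (borel T)).
  rewrite suppC; apply: negligible_bigcup => i.
  apply/negligibleP; [exact: measurable_null_basic|exact: null_basic0].
by move=> /negligibleP; apply; exact: measurable_suppC.
Qed.
End basis.
End Support.

Section Models.
Context {R : realType} {n m l : nat}.

Lemma rat_matrix_approx a b (A : 'M[R]_(a, b)) (e : R) : 0 < e ->
  exists Q : 'M[rat]_(a, b), ball (map_mx ratr Q : 'M[R]_(a, b)) e A.
Proof.
move=> e0; exists (\matrix_(i, j) sval (cid (rat_approx (A i j) e0))).
split=> // i j; rewrite !mxE; case: cid => q /= hq.
by rewrite /ball /= distrC.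
Qed.

Definition rat_model (Q : 'M[rat]_n * 'M[rat]_(n, m) * 'M[rat]_(l, n)) : model R n m l :=
  (map_mx ratr Q.1.1, map_mx ratr Q.1.2, map_mx ratr Q.2).

Lemma rat_model_dense (S : model R n m l) (e : R) : 0 < e ->
  exists Q, @ball R ('M[R]_n * 'M[R]_(n, m) * 'M[R]_(l, n))%type (rat_model Q) e S.
Proof.
case: S => [[A B] K] e0; have [QA hA] := rat_matrix_approx A e0.
have [QB hB] := rat_matrix_approx B e0; have [QK hK] := rat_matrix_approx K e0.
by exists (QA, QB, QK).
Qed.

Variable f : probability (borel (model R n m l)) R.

Let W k : set (model R n m l) := (@ball R ('M[R]_n * 'M[R]_(n, m) * 'M[R]_(l, n))%type
  (rat_model k.1) (k.2.+1%:R^-1))°.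

Let openW k : open (W k).
Proof. exact: open_interior. Qed.

Let basisW (U : set (model R n m l)) x : open U -> U x ->
  exists k, W k x /\ W k `<=` U.
Proof. exact: (countable_ball_basis rat_model_dense). Qed.

Lemma measurable_model_suppC : measurable (~` supp f : set (borel (model R n m l))).
Proof. exact: (measurable_suppC openW basisW f). Qed.

Lemma model_suppC0 : f (~` supp f) = 0%E.
Proof. exact: (suppC0 openW basisW f). Qed.
End Models.

(** * The lower bound for a fixed coupling *)

Section LowerBound.

(** For [1 < q], Young's inequality for [x] and [c ^ (q - 1)], multiplied by [q]. *)
Lemma powR_tangent (R : realType) (x c q : R) : 0 <= x -> 0 < c -> 1 <= q ->
  c `^ q + q * c `^ (q - 1) * (x - c) <= x `^ q.
Proof.
move=> x0 c0; rewrite le_eqVlt => /predU1P[<-|q1].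
  by rewrite subrr powRr0 !powRr1 ?(ltW c0)//; lra.
have q0 : 0 < q by lra.
have q10 : 0 < q - 1 by lra.
have cq : c * c `^ (q - 1) = c `^ q by rewrite mulr_powRB1// ltW.
have young : x * c `^ (q - 1) <= x `^ q / q + c `^ q / (q / (q - 1)).
  have -> : c `^ q = (c `^ (q - 1)) `^ (q / (q - 1)).
    by rewrite -powRrM mulrC divfK// gt_eqF.
  apply: conjugate_powR => //; [exact: powR_ge0|exact: divr_gt0|].
  by field; rewrite !gt_eqF.
have : q * (x * c `^ (q - 1)) <= x `^ q + c `^ q * (q - 1).
  apply: (@le_trans _ _ (q * (x `^ q / q + c `^ q / (q / (q - 1))))).
    by rewrite ler_pM2l.
  rewrite le_eqVlt; apply/orP; left; apply/eqP.
  by field; rewrite !gt_eqF.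
have -> : c `^ q + q * c `^ (q - 1) * (x - c) =
  c `^ q + q * (x * c `^ (q - 1)) - q * (c * c `^ (q - 1)) by ring.
rewrite cq; lra.
Qed.

(** Both integrals are suprema over the simple functions below the integrand, also
    when it is not measurable. *)
Lemma ge0_integral_mono d (T : measurableType d) (R : realType)
    (mu : {measure set T -> \bar R}) (D : set T) (f g : T -> \bar R) :
  (forall x, D x -> (0 <= f x)%E) -> (forall x, D x -> (f x <= g x)%E) ->
  (\int[mu]_(x in D) f x <= \int[mu]_(x in D) g x)%E.
Proof.
move=> f0 fg; have g0 x : D x -> (0 <= g x)%E.
  by move=> Dx; exact: le_trans (f0 x Dx) (fg x Dx).
rewrite !ge0_integralE//; apply: ereal_sup_le => _ [h hf <-]; exists h => // x.
apply: le_trans (hf x) _; rewrite !patchE; case: ifPn => // xD.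
by apply: fg; exact: set_mem.
Qed.

(** With [c = nom - ('E_pi[G1] + 'E_pi[G2])] positive, the tangent of [x ^ q] at [c],
    evaluated at [nom - (G1 + G2)], is a measurable lower bound for [d ^ q] with
    integral [c ^ q]. *)
Lemma tangent_integral_bound disp (T : measurableType disp) (R : realType)
    (pi : probability T R) (D : set T) (G1 G2 d : T -> R) (nom q : R) :
  measurable (~` D) -> pi (~` D) = 0%E ->
  measurable_fun setT G1 -> measurable_fun setT G2 ->
  (forall S, 0 <= G1 S <= 2) -> (forall S, 0 <= G2 S <= 2) ->
  (forall S, 0 <= d S) -> (forall S, nom <= G1 S + d S + G2 S) -> 1 <= q ->
  (poweR (maxe 0 (nom%:E - ('E_pi[G1] + 'E_pi[G2]))) q
   <= \int[pi]_(S in D) (d S `^ q)%:E)%E.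
Proof.
move=> mD piD mG1 mG2 G1b G2b d_ge0 tri q1; have q0 : 0 < q by lra.
have bounded_L1 (g : T -> R) : measurable_fun setT g -> (forall S, 0 <= g S <= 2) -> L1 pi g.
  move=> mg gb; apply: (L1_le (g := cst 2)) => //.
    by move=> S; have /andP[g0 g2] := gb S; rewrite ger0_norm.
  exact: finite_measure_integrable_cst.
have i1 : L1 pi G1.
  exact: (bounded_L1 _ mG1 G1b).
have i2 : L1 pi G2.
  exact: (bounded_L1 _ mG2 G2b).
have EE (g : T -> R) : L1 pi g -> ('E_pi[g] = (\int[pi]_S g S)%R%:E)%E.
  by move=> ig; rewrite unlock /Rintegral fineK//; exact: integrable_fin_num.
rewrite (EE _ i1) (EE _ i2) -EFinD.
set c := nom - _.
have d0 S : D S -> (0 <= (d S `^ q)%:E)%E by rewrite lee_fin powR_ge0.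
have [c0|c0] := leP c 0.
  rewrite (_ : maxe _ _ = 0%E); last by apply/max_idPl; rewrite lee_fin.
  by rewrite poweR_EFin powR0 ?gt_eqF//; apply: integral_ge0 => S DS; exact: d0.
rewrite (_ : maxe _ _ = c%:E); last by apply/max_idPr; rewrite lee_fin ltW.
rewrite poweR_EFin.
pose k := q * c `^ (q - 1).
have k0 : 0 <= k by rewrite mulr_ge0 ?powR_ge0// ltW.
pose phi S := c `^ q + k * (nom - (G1 S + G2 S) - c).
have L1cst (r : R) : L1 pi (cst r) by exact: finite_measure_integrable_cst.
have Rcst (r : R) : \int[pi]_S (cst r S) = r.
  have p1 := @probability_setT _ _ _ pi.
  by rewrite Rintegral_cst// -[X in _ * fine X]/(pi setT) p1 mulr1.
have iG : L1 pi (fun S => G1 S + G2 S) by exact: L1D.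
have phiE S : phi S = (c `^ q + k * (nom - c)) - k * (G1 S + G2 S).
  by rewrite /phi; ring.
have iphi : L1 pi phi.
  have -> : phi = (fun S => (c `^ q + k * (nom - c)) - k * (G1 S + G2 S)).
    by apply/funext => S; exact: phiE.
  exact: (L1B (L1cst _) (L1Z k iG)).
have Iphi : \int[pi]_S phi S = c `^ q.
  under eq_Rintegral do rewrite phiE.
  rewrite (RintegralB measurableT (L1cst _) (L1Z k iG)) Rcst.
  have sumE : \int[pi]_S G1 S + \int[pi]_S G2 S = nom - c by rewrite /c subKr.
  by rewrite RintegralZl// RintegralD// sumE addrK.
have phi_le S : phi S <= d S `^ q.
  apply: le_trans (powR_tangent (d_ge0 S) c0 q1).
  rewrite lerD2l; apply: ler_wpM2l => //; rewrite lerD2r lerBlDr.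
  by have := tri S; lra.
pose phip S := (Num.max (phi S) 0)%:E.
have mphi := L1_measurable iphi.
have mphip : measurable_fun setT phip.
  by apply/measurable_EFinP; apply: measurable_maxr.
have phip0 S : (0 <= phip S)%E by rewrite lee_fin le_max lexx orbT.
apply: (@le_trans _ _ (\int[pi]_S phip S)%E).
  have imax : L1 pi (fun S => Num.max (phi S) 0).
    apply: L1_le (integrable_norm iphi); first exact: measurable_maxr.
    by move=> S /=; case: (leP (phi S) 0) => h; rewrite ?normr0 ?normr_ge0.
  rewrite /phip -[leRHS]fineK; last exact: (integrable_fin_num measurableT imax).
  rewrite lee_fin -Iphi; apply: (le_Rintegral measurableT iphi imax) => S _.
  by rewrite le_max lexx.
have -> : (\int[pi]_S phip S = \int[pi]_(S in D) phip S)%E.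
  rewrite (ge0_negligible_integral mD measurableT mphip _ piD)//.
  by congr (integral _ _ _); rewrite setTD setCK.
apply: ge0_integral_mono => S DS; first exact: phip0.
by rewrite lee_fin ge_max phi_le powR_ge0.
Qed.

Section coupling.
Context {R : realType} {n m l : nat}.
Local Notation M := (borel (model R n m l)).
Variables (S1 S2 : model R n m l) (f1 f2 : probability M R).
Variable pi : probability (M * M)%type R.
Hypothesis pic : couplings f1 f2 pi.
Let D : set (M * M) := supp f1 `*` supp f2.

(** The complement of the product of the supports is covered by the null sets
    [~` supp f1] x setT and setT x [~` supp f2], whose measures are read off the
    marginals. *)
Lemma supp_prod_null : measurable (~` D) /\ pi (~` D) = 0%E.
Proof.
have m1 := measurable_model_suppC f1; have m2 := measurable_model_suppC f2.
have mN1 : measurable ((~` supp f1) `*` setT : set (M * M)) by exact: measurableX.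
have mN2 : measurable (setT `*` (~` supp f2) : set (M * M)) by exact: measurableX.
have -> : ~` D = ((~` supp f1) `*` setT) `|` (setT `*` (~` supp f2)).
  apply/seteqP; split=> [[x y] /= /not_andP[nx|ny]|[x y] [[nx _]|[_ ny]] [/= ? ?]].
  - by left.
  - by right.
  - exact: nx.
  - exact: ny.
split; first exact: measurableU.
have z1 : pi ((~` supp f1) `*` setT) = 0%E by rewrite pic.1// model_suppC0.
have z2 : pi (setT `*` (~` supp f2)) = 0%E by rewrite pic.2// model_suppC0.
by rewrite null_set_setU.
Qed.

Lemma coupling_lower_bound (q : R) : 1 <= q ->
  (poweR (maxe 0 ((delta_g S1 S2)%:E
      - ('E_pi[fun S => delta_g S1 S.1] + 'E_pi[fun S => delta_g S2 S.2]))) q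
   <= \int[pi]_(S in supp f1 `*` supp f2) (delta_g S.1 S.2 `^ q)%:E)%E.
Proof.
move=> q1; have [mD piD] := supp_prod_null.
have mG1 : measurable_fun setT (fun S : M * M => delta_g S1 S.1).
  exact: (measurableT_comp (measurable_delta_g S1) measurable_fst).
have mG2 : measurable_fun setT (fun S : M * M => delta_g S2 S.2).
  exact: (measurableT_comp (measurable_delta_g S2) measurable_snd).
have bound (S S' : model R n m l) : 0 <= delta_g S S' <= 2.
  by apply/andP; split; [exact: delta_g_ge0|exact: delta_g_le2].
apply: (tangent_integral_bound mD piD mG1 mG2 (fun S => bound S1 S.1)
  (fun S => bound S2 S.2) (fun S => delta_g_ge0 S.1 S.2) _ q1) => S.
have := delta_g_triangle S1 S.1 S2; have := delta_g_triangle S.1 S.2 S2.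
rewrite (delta_g_sym S.2 S2).
move: (delta_g S1 S.1) (delta_g S.1 S.2) (delta_g S2 S.2) (delta_g S.1 S2) (delta_g S1 S2).
move=> a b c e f; lra.
Qed.
End coupling.
End LowerBound.
Local Open Scope ereal_scope.

Theorem mainTheorem7 (R : realType) (n m l p : nat)
  (Theta1 Theta2 : set (borel 'rV[R]_p))
  (ftheta1 ftheta2 : probability (borel 'rV[R]_p) R)
  (Phi1 Phi2 : borel 'rV[R]_p -> borel (model R n m l))
  (thetabar1 thetabar2 : 'rV[R]_p)
  (Sigmabar1 Sigmabar2 : model R n m l)
  (f1 f2 : probability (borel (model R n m l)) R)
  (hf1 : perturbed_model Theta1 ftheta1 Phi1 thetabar1 Sigmabar1 f1)
  (hf2 : perturbed_model Theta2 ftheta2 Phi2 thetabar2 Sigmabar2 f2)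
  (q : R) (hq : (1 <= q)%R) :
  type_q_dist q f1 f2 >=
  ereal_inf [set poweR (maxe 0 ((delta_g Sigmabar1 Sigmabar2)%:E
                   - ('E_pi[fun S => delta_g Sigmabar1 S.1]
                      + 'E_pi[fun S => delta_g Sigmabar2 S.2]))) q
            | pi in couplings f1 f2].
Proof.
apply: le_ereal_inf_tmp => _ [pi pic <-].
apply: le_trans (coupling_lower_bound Sigmabar1 Sigmabar2 pic hq).
by apply: ereal_inf_lbound; exists pi.
Qed.
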